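(* Let $n\ge 3$ and let $\mathcal M=(G,\mathit{In},\mathit{Out},\mathit{Leak})$ be an $n$-compartment directed-cycle model (with $|\mathit{In}|\ge1$ and $|\mathit{Out}|\ge1$). Then $\mathcal M$ is generically locally identifiable if and only if $\mathcal M$ is leak-interlacing.
   Context: A linear compartmental model $\mathcal M=(G,\mathit{In},\mathit{Out},\mathit{Leak})$ consists of a finite directed graph $G=(V,E)$ with $V=\{1,\dots,n\}$ and subsets $\mathit{In},\mathit{Out},\mathit{Leak}\subseteq V$ (input, output and leak compartments); always $|\mathit{In}|\ge1$, $|\mathit{Out}|\ge1$. Each edge $j\to i$ carries a parameter $k_{ij}$ and each $\ell\in\mathit{Leak}$ carries a parameter $k_{0\ell}$; the parameter space is $\mathbb R^{|E|+|\mathit{Leak}|}$. The compartmental matrix $A=(a_{ij})$ is the $n\times n$ matrix with $a_{ii}=-\sum_{p:\,i\to p\in E}k_{pi}$ if $i\notin\mathit{Leak}$ and $a_{ii}=-k_{0i}-\sum_{p:\,i\to p\in E}k_{pi}$ if $i\in\mathit{Leak}$, and for $i\ne j$, $a_{ij}=k_{ij}$ if $j\to i\in E$ and $a_{ij}=0$ otherwise. For each $i\in\mathit{Out}$ the input-output equation is $\det(\partial I-A)\,y_i=\sum_{j\in\mathit{In}}(-1)^{i+j}\det[(\partial I-A)^{j,i}]\,u_j$, where $\partial=d/dt$, $I$ is the identity, and $B^{j,i}$ denotes $B$ with row $j$ and column $i$ removed. Expanded, each side is a linear combination of derivatives $y_i^{(d)}$, $u_j^{(d)}$ with coefficients that are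 polynomials in the parameters. The coefficient map $\mathsf c:\mathbb R^{|E|+|\mathit{Leak}|}\to\mathbb R^m$ sends a parameter vector to a vector of these coefficients (over all $i\in\mathit{Out}$) containing all non-constant coefficients. The model is generically locally identifiable if, outside a set of measure zero, every point of the parameter space has a neighborhood on which $\mathsf c$ is injective; for strongly connected models (such as directed-cycle models) this is equivalent to the Jacobian matrix of $\mathsf c$ having rank $|E|+|\mathit{Leak}|$ at a generic point. A directed-cycle model has $n\ge3$, $V=\{1,\dots,n\}$, $E=\{1\to2,2\to3,\dots,(n-1)\to n,n\to1\}$; compartment indices are taken modulo $n$. An $n$-compartment directed-cycle model is exceptional if for some $1\le i\le n$: $\mathit{In}=\{i\}$, $\mathit{Out}=\{i-1\}$, $|\mathit{Leak}|=2$ and $i-1\in\mathit{Leak}$ (with $i-1$ taken mod $n$). A directed-cycle model is leak-interlacing if it is not exceptional and either (1) $|\mathit{Leak}|\le1$, or (2) $|\mathit{Leak}|\ge2$, $\mathit{Leak}=\{\ell_1,\dots,\ell_z\}$ with $1\le\ell_1<\dots<\ell_z\le n$, and for every $\alpha\in\{1,\dots,z\}$ one has $\{\ell_\alpha+1,\ell_\alpha+2,\dots,\ell_{\alpha+1}\}\cap(\mathit{In}\cup\mathit{Out})\ne\emptyset$, where $\ell_{z+1}:=\ell_1$ and the compartments $\ell_z+1,\ell_z+2,\dots,\ell_1$ are taken mod $n$ (i.e., the vertices along the directed path of the cycle from $\ell_\alpha+1$ to $\ell_{\alpha+1}$, a single vertex if $\ell_\alpha+1=\ell_{\alpha+1}$).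 *)

(* Defs.v *)
From HB Require Import structures.
From mathcomp Require Import all_boot all_order all_algebra.
From mathcomp Require Import all_classical all_reals all_analysis.

Set Implicit Arguments.
Unset Strict Implicit.
Unset Printing Implicit Defensive.

Import Order.TTheory GRing.Theory Num.Theory.
Import numFieldNormedType.Exports.
Local Open Scope classical_set_scope.
Local Open Scope ring_scope.

(* Compartments 1, ..., n are represented by 0, ..., n - 1 in 'I_n.           *)
(* A pair (j, i) in edges stands for j -> i.                                  *)
Record model (n : nat) := Model {
  edges : {set 'I_n * 'I_n};
  inputs : {set 'I_n};
  outputs : {set 'I_n};
  leaks : {set 'I_n};
  inputs_gt0 : (0 < #|inputs|)%N;
  outputs_gt0 : (0 < #|outputs|)%N
}.

Section Identifiability.
Variables (R : realType) (n : nat) (M : model n).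

(* The index of k_ij is inl (j, i) for an edge j -> i; that of k_0l is inr l. *)
Definition param_index : finType :=
  ({e : 'I_n * 'I_n | e \in edges M} + {l : 'I_n | l \in leaks M})%type.

Definition params := 'rV[R]_#|param_index|.

(* k_ij, extended by 0 when j -> i is not an edge. *)
Definition edge_param (k : params) (i j : 'I_n) : R :=
  if insub (j, i) is Some e then k 0 (enum_rank (inl e : param_index)) else 0.

(* k_0l, extended by 0 when l is not a leak compartment. *)
Definition leak_param (k : params) (l : 'I_n) : R :=
  if insub l is Some x then k 0 (enum_rank (inr x : param_index)) else 0.

Definition compartmental_matrix (k : params) : 'M[R]_n :=
  \matrix_(i, j)
    if i == j then
      - leak_param k i - \sum_(p | (i, p) \in edges M) edge_param k p i
    else edge_param k i j.

(* Both sides of an input-output equation are polynomials in d/dt = 'X applied *)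
(* to y_i and to the u_j; the library's cofactor j i B includes the sign       *)
(* (-1)^(i+j) and deletes row j and column i of B.                             *)
Definition output_poly (k : params) : {poly R} :=
  \det (char_poly_mx (compartmental_matrix k)).

Definition input_poly (k : params) (i j : 'I_n) : {poly R} :=
  cofactor (char_poly_mx (compartmental_matrix k)) j i.

(* Degrees are at most n on the left-hand side and at most n - 1 on the        *)
(* right-hand side.                                                            *)
Definition coefficient_index : finType :=
  ({i : 'I_n | i \in outputs M} * ('I_n.+1 + {j : 'I_n | j \in inputs M} * 'I_n))%type.

Definition io_coefficient (k : params) (x : coefficient_index) : R :=
  match x with
  | (i, inl d) => (output_poly k)`_d
  | (i, inr (j, d)) => (input_poly k (val i) (val j))`_d
  end.

(* All the coefficients are listed, the constant ones included. *)
Definition coefficient_map (k : params) : 'rV[R]_#|coefficient_index| :=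
  \row_m io_coefficient k (enum_val m).

End Identifiability.

Definition box (R : realType) (N : nat) (a b : 'rV[R]_N) : set 'rV[R]_N :=
  [set x | forall i, a 0 i <= x 0 i <= b 0 i].

(* Lebesgue-null subsets of R^N: those covered by countably many boxes of      *)
(* arbitrarily small total volume.                                             *)
Definition measure_zero (R : realType) (N : nat) (Z : set 'rV[R]_N) : Prop :=
  forall eps : R, 0 < eps ->
    exists a b : nat -> 'rV[R]_N,
      [/\ forall m i, a m 0 i <= b m 0 i,
          Z `<=` \bigcup_m box (a m) (b m) &
          (\sum_(0 <= m <oo) (\prod_i (b m 0 i - a m 0 i))%:E <= eps%:E)%E].

Definition generically_locally_identifiable
    (R : realType) (n : nat) (M : model n) : Prop :=
  exists Z : set (params R M), measure_zero Z /\
    forall k : params R M, ~ Z k ->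
      exists U : set (params R M), nbhs k U /\ set_inj U (@coefficient_map R n M).

Section DirectedCycle.
Variables (n : nat) (M : model n).

(* ordS and ord_pred are the successor and predecessor modulo n. *)
Definition directed_cycle : Prop :=
  edges M = [set (i, ordS i) | i : 'I_n]%SET.

Definition exceptional : Prop :=
  exists i : 'I_n,
    [/\ inputs M = [set i]%SET, outputs M = [set ord_pred i]%SET,
        #|leaks M| = 2%N & ord_pred i \in leaks M].

(* The vertices a, a + 1, ..., b (mod n) of the directed path from a to b:     *)
(* those at most as far from a along the cycle as b is.                        *)
Definition cycle_segment (a b : 'I_n) : {set 'I_n} :=
  [set v : 'I_n | ((v + n - a) %% n <= (b + n - a) %% n)%N]%SET.

(* enum lists 'I_n in increasing order, so next (enum (leaks M)) maps          *)
(* l_alpha to l_(alpha+1) and l_z to l_1.                                      *)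
Definition leak_interlacing : Prop :=
  ~ exceptional /\
  ((#|leaks M| <= 1)%N \/
   ((2 <= #|leaks M|)%N /\
    forall l : 'I_n, l \in leaks M ->
      cycle_segment (ordS l) (next (enum (leaks M)) l)
        :&: (inputs M :|: outputs M) != finset.set0)).

End DirectedCycle.

(* Main.v *)
(** Write k_v for the rate of the edge v -> v+1, d_v for k_v plus the leak rate of v,
    and c for the product of all the k_v. The left-hand side of the input-output
    equations is prod_v (X + d_v) - c, and the right-hand side for an input j and an
    output i is the product of the k_v along the path from j to i times the product
    of the X + d_v over the vertices v off that path.

    If some path misses a vertex v, then - d_v is a root of the right-hand side, and
    evaluating the left-hand side there gives c, hence all the d_v, which are generically
    distinct. It remains to recover the k_v for v in Leak from their products along the
    paths and around the cycle: the ratio of two solutions is a coboundary g(v+1) / g(v)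
    where g is constant on In and Out and on each segment between consecutive leaks, so
    it is trivial if every segment meets In or Out; otherwise the k_v of the two leaks
    bounding an empty segment can be rescaled inversely to each other.

    If In = {j} and Out = {j-1}, put v = j-1 and K = prod_(u <> v) k_u. With at most one
    leak, - d_v is a root of prod_u (X + d_u) - K (X + d_v), a polynomial that the
    coefficients determine, and generically it is a simple one. In the exceptional case
    one may move c by a small amount t, let the d_u follow the roots of
    prod_u (X + d_u) + t, and still adjust the two leaks. *)

Require Import Defs.
From HB Require Import structures.
From mathcomp Require Import all_boot all_order all_algebra.
From mathcomp Require Import all_classical all_reals all_analysis.
From mathcomp Require Import measurable_realfun.
From mathcomp Require Import zify ring lra.

Set Implicit Arguments.
Unset Strict Implicit.
Unset Printing Implicit Defensive.

Import Order.TTheory GRing.Theory Num.Theory.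
Import numFieldNormedType.Exports.
Local Open Scope classical_set_scope.
Local Open Scope ring_scope.

(** * Cyclic distance and cyclic bidiagonal matrices *)

(** The expression compared in [cycle_segment]: membership of [v] in [cycle_segment a b] unfolds to
    [cycle_dist a v <= cycle_dist a b]. *)
Definition cycle_dist (n : nat) (a b : 'I_n) : nat := ((b + n - a) %% n)%N.

Lemma cycle_distE n (a b : 'I_n) :
  cycle_dist a b = if (a <= b)%N then (b - a)%N else (b + n - a)%N.
Proof.
rewrite /cycle_dist; case: leqP => ab.
- by rewrite -addnBAC // modnDr modn_small // (leq_ltn_trans (leq_subr _ _)).
- by rewrite modn_small //; have := ltn_ord b; lia.
Qed.

Lemma val_ordS n (v : 'I_n) : ordS v = (if v.+1 < n then v.+1 else 0)%N :> nat.
Proof.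
rewrite /=; case: ifP => h; first by rewrite modn_small.
by rewrite (_ : v.+1 = n) ?modnn //; have := ltn_ord v; lia.
Qed.

Lemma eq_ordS n (u v : 'I_n) :
  (u == ordS v) = (u == (if v.+1 < n then v.+1 else 0) :> nat)%N.
Proof. by rewrite -val_ordS. Qed.

Lemma cycle_dist_lt n (a b : 'I_n) : (cycle_dist a b < n)%N.
Proof. by rewrite cycle_distE; move: (ltn_ord a) (ltn_ord b); case: ifP; lia. Qed.

Lemma cycle_dist_inj n (a : 'I_n) : injective (cycle_dist a).
Proof.
move=> b c; rewrite !cycle_distE => h; apply: val_inj => /=.
by move: h (ltn_ord a) (ltn_ord b) (ltn_ord c); do 2!case: ifP; lia.
Qed.

Lemma cycle_distxx n (a : 'I_n) : cycle_dist a a = 0%N.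
Proof. by rewrite cycle_distE leqnn subnn. Qed.

Lemma cycle_dist_ordS n (a b : 'I_n) : ordS b != a ->
  cycle_dist a (ordS b) = (cycle_dist a b).+1.
Proof.
rewrite !cycle_distE; move: (ordS b) (val_ordS b) => c; rewrite -val_eqE /=.
by move: (ltn_ord a) (ltn_ord b); do 3!case: ifP; lia.
Qed.

Lemma cycle_dist_max n (a b : 'I_n) : ordS b = a -> cycle_dist a b = n.-1.
Proof.
move=> /(congr1 (@nat_of_ord n)); rewrite val_ordS cycle_distE.
by move: (ltn_ord a) (ltn_ord b); case: ifP; case: ifP; lia.
Qed.

(** Induction on the distance from [a]. The step into [a] itself is excluded, since there the
    distance drops from n - 1 back to 0. *)
Lemma cycle_ind n (a : 'I_n) (P : 'I_n -> Prop) : P a ->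
  (forall v, ordS v != a -> P v -> P (ordS v)) -> forall v, P v.
Proof.
move=> Pa PS v; have [m] := ubnP (cycle_dist a v).
elim: m v => // m IH v; rewrite ltnS => vm.
have [->//|va] := eqVneq v a.
have := @cycle_dist_ordS _ a (ord_pred v); have := PS (ord_pred v).
by rewrite ord_predK => /(_ va) h /(_ va) e; apply/h/IH; rewrite -e.
Qed.

Section CyclicMatrix.
Variables (T : comNzRingType) (n : nat) (D k : 'I_n -> T).

(** The shape of the characteristic matrix of a directed cycle, with [D v] for X + d_v and [k v] for
    the rate of the edge out of [v]. *)
Definition cyclic_mx : 'M[T]_n :=
  \matrix_(i, j) if i == j then D i else if i == ordS j then - k j else 0.

(** The path from [j] to [i] uses the edges leaving the vertices strictly before [i]; the vertices
    strictly after [i], counted from [j], are off it. *)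
Definition path_prod (j i : 'I_n) : T :=
  \prod_(v | (cycle_dist j v < cycle_dist j i)%N) k v.

Definition off_path_prod (j i : 'I_n) : T :=
  \prod_(v | (cycle_dist j i < cycle_dist j v)%N) D v.

(** The products are the guessed entries of the adjugate. Only the columns [i] and [ord_pred i]
    contribute to row [i]; the two terms cancel unless [i = j], where they are the full products of
    [D] and of [k]. *)
Lemma cyclic_mx_mul (j : 'I_n) (i : 'I_n) : (1 < n)%N ->
  \sum_v cyclic_mx i v * (path_prod j v * off_path_prod j v) =
  (\prod_v D v - \prod_v k v) *+ (i == j).
Proof.
move=> n1.
have ii : ord_pred i != i.
  apply/eqP => /(congr1 (fun v => nat_of_ord (ordS v))); rewrite ord_predK val_ordS.
  by move: (ltn_ord i); case: ifP; lia.
rewrite (bigD1 i) //= (bigD1 (ord_pred i)) //= big1 ?addr0; last first.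
  move=> v /andP[vi vpi]; rewrite mxE eq_sym (negPf vi).
  by rewrite ifF ?mul0r //; apply: contraNF vpi => /eqP ->; rewrite ordSK.
rewrite !mxE eqxx eq_sym (negPf ii) ord_predK eqxx mulNr.
have kE : k (ord_pred i) * path_prod j (ord_pred i) =
    \prod_(v | (cycle_dist j v <= cycle_dist j (ord_pred i))%N) k v.
  rewrite [RHS](bigD1 (ord_pred i)) //=; congr (_ * _); apply: eq_bigl => v.
  rewrite ltn_neqAle andbC; congr (_ && ~~ _).
  by apply/eqP/eqP => [/cycle_dist_inj|->].
have DE : D i * off_path_prod j i =
    \prod_(v | (cycle_dist j i <= cycle_dist j v)%N) D v.
  rewrite [RHS](bigD1 i) //=; congr (_ * _); apply: eq_bigl => v.
  rewrite ltn_neqAle andbC eq_sym; congr (_ && ~~ _).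
  by apply/eqP/eqP => [/cycle_dist_inj|->].
rewrite mulrCA DE mulrA kE; have [<-|ij] := eqVneq i j.
  rewrite mulr1n /path_prod /off_path_prod cycle_distxx big_pred0 // mul1r.
  rewrite cycle_dist_max ?ord_predK // [X in _ - _ * X]big_pred0 ?mulr1; last first.
    by move=> v; have := cycle_dist_lt i v; lia.
  congr (_ - _); apply: eq_bigl => v //.
  by have := cycle_dist_lt i v; lia.
rewrite mulr0n; have := @cycle_dist_ordS _ j (ord_pred i); rewrite ord_predK => /(_ ij) e.
by rewrite /path_prod /off_path_prod e; under eq_bigl do rewrite ltnS; rewrite subrr.
Qed.

End CyclicMatrix.

(** Expansion along the first row meets only the diagonal entry and the corner entry in the last
    column. Both minors are triangular, and the sign of the corner cofactor cancels the signs of the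
    entries in its minor. *)
Lemma det_cyclic_mx (T : comNzRingType) (n : nat) (D k : 'I_n -> T) : (1 < n)%N ->
  \det (cyclic_mx D k) = \prod_v D v - \prod_v k v.
Proof.
case: n D k => [//|[//|n]] D k _.
rewrite (expand_det_row _ ord0) big_ord_recl big_ord_recr /= big1 ?add0r; last first.
  move=> i _; rewrite mxE eq_ordS -val_eqE /= /bump /=.
  by move: (ltn_ord i); do 3?case: ifP; rewrite ?mul0r //; lia.
rewrite !mxE eqxx eq_ordS [ord0 == _]/= /= /bump /= !add1n ltnn eqxx.
rewrite /cofactor /=.
rewrite det_trig; last first.
  apply/is_trig_mxP => i j ij; rewrite !mxE eq_ordS -val_eqE /= /bump /=.
  by move: (ltn_ord i) (ltn_ord j); do 3?case: ifP; rewrite //; lia.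
rewrite -det_tr det_trig; last first.
  apply/is_trig_mxP => i j ij; rewrite !mxE eq_ordS -val_eqE /= /bump /=.
  by move: (ltn_ord i) (ltn_ord j); do 3?case: ifP; rewrite //; lia.
rewrite [X in _ = X - _]big_ord_recl [X in _ = _ - X]big_ord_recr /= expr0 mul1r.
congr (_ * _ + _).
  by apply: eq_bigr => i _; rewrite !mxE eqxx.
rewrite (eq_bigr (fun i : 'I_n.+1 => - k (widen_ord (leqnSn n.+1) i))); last first.
  move=> i _; rewrite !mxE.
  have -> : lift (lift ord0 ord_max) i = widen_ord (leqnSn n.+1) i.
    by apply: val_inj; rewrite /= /bump leqNgt ltn_ord.
  rewrite eq_ordS -val_eqE /= /bump /=.
  by move: (ltn_ord i); do 3?case: ifP => //; lia.
rewrite prodrN card_ord.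
have -> : lift ord0 ord_max = ord_max :> 'I_n.+2 by apply: val_inj.
by rewrite (mulrA ((-1) ^+ _)) -expr2 sqrr_sign mul1r mulNr mulrC.
Qed.

(** With B the cyclic matrix and C the matrix of these products, [cyclic_mx_mul] reads B C = (det B)
    I. Multiplying by the adjugate and cancelling the non-zero determinant leaves C = adj B. *)
Lemma cofactor_cyclic_mx (T : idomainType) (n : nat) (D k : 'I_n -> T) (i j : 'I_n) :
  (1 < n)%N -> \prod_v D v != \prod_v k v ->
  cofactor (cyclic_mx D k) j i = path_prod k j i * off_path_prod D j i.
Proof.
move=> n1 dn0; pose C := \matrix_(i, j) (path_prod k j i * off_path_prod D j i).
have BC : cyclic_mx D k *m C = (\prod_v D v - \prod_v k v)%:M.
  apply/matrixP => u v; rewrite !mxE -cyclic_mx_mul //.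
  by apply: eq_bigr => w _; rewrite [in X in _ * X]mxE.
have := congr1 (mulmx (\adj (cyclic_mx D k))) BC.
rewrite mulmxA mul_adj_mx det_cyclic_mx // mul_scalar_mx mul_mx_scalar.
move=> /matrixP/(_ i j); rewrite !mxE => /(mulfI _) -> //.
by rewrite subr_eq0.
Qed.

(** * Null sets *)

Section NullSets.
Variable R : realType.

(* Fubini by hand: integrating the inequality for the slices over one coordinate. *)
Lemma weighted_box_cover_ge1 (N : nat) (c : nat -> R) (lo : 'I_N -> R)
    (a b : nat -> 'I_N -> R) :
  (forall m, 0 <= c m) -> (forall m i, a m i <= b m i) ->
  (forall x : 'I_N -> R, (forall i, lo i <= x i <= lo i + 1) ->
    (1 <= \sum_(0 <= m <oo) (c m * [forall i, a m i <= x i <= b m i]%:R)%:E)%E) ->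
  (1 <= \sum_(0 <= m <oo) (c m * \prod_i (b m i - a m i))%:E)%E.
Proof.
elim: N c lo a b => [|N IH] c lo a b c0 ab cov.
  rewrite (eq_eseriesr (g := fun m => (c m * [forall i, a m i <= 0 <= b m i]%:R)%:E)).
    by apply: (cov (fun=> 0)); case.
  by move=> m _; rewrite big_ord0; congr (_ * _)%:E; case: forallP => // -[] [].
pose C m := c m * \prod_(i < N) (b m (lift ord0 i) - a m (lift ord0 i)).
have C0 m : 0 <= C m.
  by rewrite mulr_ge0 // prodr_ge0 // => i _; rewrite subr_ge0.
pose D := `[lo ord0, lo ord0 + 1]%classic.
pose f m (t : R) : \bar R := ((C m)%:E * (\1_(`[a m ord0, b m ord0]%classic) t)%:E)%E.
have slice t : D t -> (1 <= \sum_(0 <= m <oo) f m t)%E.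
  rewrite /D /= in_itv /= => tD.
  (* Freezing the first coordinate at [t] gives weight 0 to the boxes that miss [t]; the weights in
     the statement make this an instance of the induction hypothesis. *)
  rewrite (eq_eseriesr (g := fun m => (c m * (a m ord0 <= t <= b m ord0)%R%:R *
      \prod_(i < N) (b m (lift ord0 i) - a m (lift ord0 i)))%:E)); last first.
    move=> m _; rewrite /f indicE -EFinM; congr (_%:E).
    by rewrite mem_setE /= in_itv /= /C mulrAC.
  apply: (IH (fun m => c m * (a m ord0 <= t <= b m ord0)%R%:R) (fun i => lo (lift ord0 i))
    (fun m i => a m (lift ord0 i)) (fun m i => b m (lift ord0 i))) => //.
    by move=> m; rewrite mulr_ge0.
  move=> x xlo; pose y i := if unlift ord0 i is Some j then x j else t.
  rewrite (eq_eseriesr (g := fun m => (c m * [forall i, a m i <= y i <= b m i]%:R)%:E)).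
    by apply: cov => i; rewrite /y; case: unliftP => [j ->|->].
  move=> m _; congr (_%:E); rewrite -mulrA -natrM mulnb; congr (_ * (nat_of_bool _)%:R); apply/esym.
  apply/forallP/andP => [h|[h0 /forallP h] i].
    split; first by have := h ord0; rewrite /y unlift_none.
    by apply/forallP => i; have := h (lift ord0 i); rewrite /y liftK.
  by rewrite /y; case: unliftP => [j ->|->].
have mf m : measurable_fun D (f m).
  by apply: measurable_funeM; apply/measurable_EFinP; apply: measurable_indic.
have f0 m x : D x -> (0 <= f m x)%E.
  by move=> _; rewrite mule_ge0 ?lee_fin.
have mD : measurable D by exact: measurable_itv.
have mu1 : (\int[@lebesgue_measure R]_(t in D) cst 1 t = 1)%E.
  rewrite integral_cst // mul1e; apply: (etrans (lebesgue_measure_itv _)) => /=.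
  by rewrite lte_fin ltrDl ltr01 -EFinB addrAC subrr add0r.
rewrite -[X in (X <= _)%E]mu1.
apply: (@le_trans _ _ (\int[@lebesgue_measure R]_(t in D) \sum_(0 <= m <oo) f m t)%E).
  apply: ge0_le_integral => //.
  by apply: (@ge0_emeasurable_sum _ _ _ D f xpredT) => // m x Dx _; exact: f0.
rewrite integral_nneseries //.
apply: lee_nneseries => [m _ _|m _].
  by apply: integral_ge0 => x Dx; exact: f0.
rewrite ge0_integralZl_EFin //; last first.
  by apply/measurable_EFinP; apply: measurable_indic.
rewrite integral_indic //.
have -> : c m * \prod_i (b m i - a m i) = C m * (b m ord0 - a m ord0).
  by rewrite big_ord_recl /C mulrCA mulrC.
rewrite (EFinM (C m)); apply: lee_wpmul2l; first by rewrite lee_fin.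
apply: (le_trans (le_measure _ _ _ (@subIsetl _ _ _))); rewrite ?inE //.
  exact: measurableI.
rewrite [X in (X <= _)%E](lebesgue_measure_itv `[a m ord0, b m ord0]) /=.
rewrite lte_fin; case: ltP => _; rewrite ?lee_fin ?subr_ge0 //.
Qed.

(** A null unit cube would have a cover of total volume at most 1/2, against
    [weighted_box_cover_ge1] with all weights 1. This later picks a good parameter vector in a
    prescribed cube. *)
Lemma measure_zero_avoid (N : nat) (Z : set 'rV[R]_N) (lo : 'I_N -> R) :
  measure_zero Z -> exists2 x, ~ Z x & forall i, lo i <= x 0 i <= lo i + 1.
Proof.
move=> Z0; apply: contrapT => h.
have [a [b [ab cov]]] := Z0 (2^-1) ltac:(by rewrite invr_gt0).
apply/negP; rewrite -ltNge; apply: (@lt_le_trans _ _ 1%E).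
  by rewrite lte_fin; lra.
under eq_eseriesr do rewrite -(mul1r (\prod_i _)).
apply: (@weighted_box_cover_ge1 _ (fun=> 1) lo
  (fun m i => a m 0 i) (fun m i => b m 0 i)) => // x xlo.
have [] : (\bigcup_m box (a m) (b m)) (\row_i x i).
  apply: cov; apply: contrapT => nZ; apply: h; exists (\row_i x i) => // i.
  by rewrite mxE.
move=> m _ xm.
apply: (le_trans _ (nneseries_lim_ge m.+1 _)); last by move=> i _; rewrite lee_fin mul1r.
rewrite big_nat_recr //= (_ : [forall j, _]); last first.
  by apply/forallP => i; have := xm i; rewrite mxE.
by rewrite mulr1 leeDr // sume_ge0 // => i _; rewrite lee_fin mul1r.
Qed.

Lemma measure_zero_sub (N : nat) (Z Z' : set 'rV[R]_N) :
  Z `<=` Z' -> measure_zero Z' -> measure_zero Z.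
Proof.
move=> ZZ' Z0 eps /Z0[a [b [ab cov s]]]; exists a, b; split => //.
exact: subset_trans cov.
Qed.

(** The n-th set receives a cover of volume at most eps / 2^(n+1), and a bijection of nat with nat *
    nat merges the covers into one sequence. *)
Lemma measure_zero_bigcup (N : nat) (Z : nat -> set 'rV[R]_N) :
  (forall m, measure_zero (Z m)) -> measure_zero (\bigcup_m Z m).
Proof.
move=> Z0 eps eps0.
have [G PG] : {G : nat -> (nat -> 'rV[R]_N) * (nat -> 'rV[R]_N) & forall n,
    [/\ forall m i, (G n).1 m 0 i <= (G n).2 m 0 i,
        Z n `<=` \bigcup_m box ((G n).1 m) ((G n).2 m) &
        (\sum_(0 <= m <oo) (\prod_i ((G n).2 m 0 i - (G n).1 m 0 i))%:E <=
         (eps / (2 ^ n.+1)%:R)%:E)%E]}.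
  apply: (@choice _ _ (fun n (g : (nat -> 'rV[R]_N) * (nat -> 'rV[R]_N)) =>
    [/\ forall m i, g.1 m 0 i <= g.2 m 0 i,
        Z n `<=` \bigcup_m box (g.1 m) (g.2 m) &
        (\sum_(0 <= m <oo) (\prod_i (g.2 m 0 i - g.1 m 0 i))%:E <=
         (eps / (2 ^ n.+1)%:R)%:E)%E])) => n.
  have [|a [b h]] := Z0 n (eps / (2 ^ n.+1)%:R).
    by rewrite divr_gt0 // ltr0n expn_gt0.
  by exists (a, b).
have /card_esym/ppcard_eqP[f] := card_nat2.
exists (fun k => (G (f k).1).1 (f k).2), (fun k => (G (f k).1).2 (f k).2).
split => [m i|x [n _]|].
- by case: (PG (f m).1).
- case: (PG n) => _ cov _ /cov[m _ xb].
  by exists (f^-1%FUN (n, m)) => //; rewrite invK ?inE.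
pose vol (p : nat * nat) : \bar R :=
  (\prod_i ((G p.1).2 p.2 0 i - (G p.1).1 p.2 0 i))%:E.
have vol0 p : (0 <= vol p)%E.
  rewrite lee_fin prodr_ge0 // => i _; rewrite subr_ge0.
  by case: (PG p.1).
rewrite -(esum_pred_image vol f xpredT) ?[fun=> _]set_true //.
rewrite image_eq (_ : [set: nat * nat] = [set: nat] `*`` (fun=> [set: nat])); last first.
  by apply/seteqP; split.
rewrite -(@esum_esum _ _ _ _ (fun=> setT) (fun i j => vol (i, j))) //.
under eq_esum do rewrite -nneseries_esumT //.
rewrite -nneseries_esumT; last by move=> n; apply: nneseries_ge0.
apply: (@le_trans _ _ (\sum_(0 <= i <oo) (0 + (eps / (2 ^ i.+1)%:R)%:E))%E).
  apply: lee_nneseries => [n _ _|n _]; first exact: nneseries_ge0.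
  by rewrite add0e; case: (PG n).
apply: (le_trans (epsilon_trick _ _ _)) => //; first exact: ltW.
by rewrite eseries0 ?add0e.
Qed.

(** The finite family is padded with the degenerate box at 0. The coordinate [i0] makes its volume
    0; with no coordinates the empty product would be 1. *)
Lemma measure_zero_finite_cover (N : nat) (i0 : 'I_N) (Z : set 'rV[R]_N) :
  (forall eps : R, 0 < eps -> exists (T : finType) (a b : T -> 'rV[R]_N),
    [/\ forall t i, a t 0 i <= b t 0 i,
        Z `<=` \bigcup_t box (a t) (b t) &
        \sum_t \prod_i (b t 0 i - a t 0 i) <= eps]) -> measure_zero Z.
Proof.
move=> h eps /h[T [a [b [ab cov s]]]].
pose ext (u : T -> 'rV[R]_N) (m : nat) : 'rV[R]_N :=
  if insub m is Some o then u (@enum_val T xpredT o) else 0.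
exists (ext a), (ext b); split => [m i|x /cov[t _ xt]|].
- by rewrite /ext; case: insubP.
- exists (enum_rank t) => //; rewrite /ext; case: insubP => [p _ pE|].
    by rewrite (val_inj pE) enum_rankK.
  by rewrite ltn_ord.
rewrite (@nneseries_split _ _ 0 #|T|); last first.
  move=> m _; rewrite lee_fin prodr_ge0 // => i _; rewrite subr_ge0 /ext.
  by case: insubP.
rewrite [X in (_ + X)%E]eseries0 ?adde0; last first.
  move=> m; rewrite add0n leqNgt => mT _; rewrite /ext insubN //.
  by rewrite (bigD1 i0) //= mxE subrr mul0r.
rewrite add0n big_mkord sumEFin lee_fin; apply: le_trans s.
rewrite le_eqVlt; apply/orP; left; apply/eqP.
rewrite [RHS](reindex (@enum_val T xpredT)) /=; last first.
  by apply: onW_bij; apply: enum_val_bij.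
apply: eq_bigr => o _; rewrite /ext; case: insubP => [p _ /val_inj ->|] //.
by rewrite ltn_ord.
Qed.

Lemma grid_cell (lo w x : R) (q : nat) : (0 < q)%N -> lo <= x <= lo + w ->
  exists c : 'I_q, lo + w * (c%:R / q%:R) <= x <= lo + w * (c.+1%:R / q%:R).
Proof.
move=> q0 /andP[xlo xhi].
have ex : exists c, x <= lo + w * (c.+1%:R / q%:R).
  by exists q.-1; rewrite prednK // divff ?mulr1 // pnatr_eq0 -lt0n.
case: (ex_minnP ex) => c xc cmin.
have cq : (c < q)%N.
  rewrite -(prednK q0) ltnS; apply: cmin.
  by rewrite prednK // divff ?mulr1 // pnatr_eq0 -lt0n.
exists (Ordinal cq) => /=; rewrite xc andbT.
case: c xc cmin cq => [|c] xc cmin cq; first by rewrite mul0r mulr0 addr0.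
by rewrite leNgt; apply/negP => /ltW /cmin; rewrite ltnn.
Qed.

(** Compactness of the cube, in its near-covering form, turns the local moduli of continuity into a
    single [d]. *)
Lemma uniform_continuity_cube (N : nat) (f : 'rV[R]_N -> R) (M e : R) :
  continuous f -> 0 < e -> exists2 d, 0 < d &
    forall x y : 'rV[R]_N, (forall i, `|x 0 i| <= M) ->
      (forall i, `|x 0 i - y 0 i| <= d) -> `|f x - f y| <= e.
Proof.
move=> cf e0.
have cK : compact [set v : 'rV[R]_N | forall i, `[- M, M]%classic (v 0 i)].
  by apply: (@rV_compact _ _ (fun=> `[- M, M]%classic)) => i; exact: segment_compact.
have /compact_near_coveringP := cK.
move=> /(_ R (0^'+) (fun d x => forall y : 'rV[R]_N,
  (forall i, `|x 0 i - y 0 i| <= d) -> `|f x - f y| <= e) _) [|].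
  move=> x _.
  have /cvgrPdist_lt/(_ (e / 2)) := cf x; rewrite divr_gt0 // => /(_ isT).
  move=> /nbhs_ballP[r /= r0 rf].
  exists (ball x (r / 2), [set d | d < r / 2]) => /=.
    split; first by apply: nbhsx_ballx; rewrite divr_gt0.
    by apply: nbhs_right_lt; rewrite divr_gt0.
  move=> [x' d] /= [[_ xx'] dr] y x'y.
  have h1 : `|f x - f x'| < e / 2.
    apply: rf; split => // i j; apply: le_ball (xx' i j); lra.
  have h2 : `|f x - f y| < e / 2.
    apply: rf; split => // i j; rewrite (ord1 i).
    apply: (@ball_split _ _ (x' 0 j)); first exact: xx'.
    by apply: le_lt_trans (x'y j) dr.
  rewrite (_ : f x' - f y = (f x - f y) - (f x - f x')); last by ring.
  by apply: (le_trans (ler_normB _ _)); rewrite (splitr e) lerD // ltW.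
move=> d /= d0 dP; exists (d / 2); first by rewrite divr_gt0.
move=> x y xM xy; apply: (dP (d / 2)) => //.
- by rewrite /= sub0r normrN gtr0_norm ?divr_gt0 // ltr_pdivrMr // ltr_pMr // ltr1n.
- by rewrite divr_gt0.
- by move=> i /=; rewrite in_itv /= -ler_norml.
Qed.

(** Where [|a|] is at least 1 / M, the equation makes x_i a uniformly continuous function - b / a of
    the other coordinates. Over each cell of a fine grid in those coordinates, the set therefore
    lies in a slab of height 2 h. *)
Lemma measure_zero_graph_cube (N : nat) (i : 'I_N) (a b : 'rV[R]_N -> R) (M : R) :
  1 <= M -> continuous a -> continuous b ->
  (forall x y : 'rV[R]_N, (forall j, j != i -> x 0 j = y 0 j) ->
     a x = a y /\ b x = b y) ->
  measure_zero [set x : 'rV[R]_N | [/\ forall j, `|x 0 j| <= M,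
    1 <= M * `|a x| & a x * x 0 i + b x = 0]].
Proof.
move=> M1 ca cb indep; set S := mkset _.
have M0 : 0 < M by apply: lt_le_trans M1.
apply: (measure_zero_finite_cover i) => eps eps0.
pose W : R := \prod_(j < N | j != i) (2 * M).
have W0 : 0 < W by apply: prodr_gt0 => j _; rewrite mulr_gt0.
pose h := eps / (2 * W).
have h0 : 0 < h by rewrite divr_gt0 ?mulr_gt0.
(* If [a] and [b] vary by at most [e], then x_i varies by at most M (e + e M) = h. *)
pose e := h / (M * (M + 1)).
have e0 : 0 < e by rewrite divr_gt0 // mulr_gt0 // addr_gt0.
have [da da0 ua] := uniform_continuity_cube M ca e0.
have [db db0 ub] := uniform_continuity_cube M cb e0.
pose d := Num.min da db.
have d0 : 0 < d by rewrite lt_min da0.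
pose q := (Num.truncn (2 * M / d)).+1.
have qd : 2 * M / q%:R <= d.
  rewrite ler_pdivrMr ?ltr0n // -ler_pdivrMl // mulrC ltW //.
  by apply: truncnS_gt.
have close x y : S x -> S y -> (forall j, j != i -> `|x 0 j - y 0 j| <= d) ->
    `|x 0 i - y 0 i| <= h.
  move=> [xM xa xE] [yM ya yE] xy.
  (* Neither [a] nor [b] sees coordinate [i], so it may be moved to that of [x]; then [x] and [y']
     are close in every coordinate. *)
  pose y' : 'rV[R]_N := \row_j if j == i then x 0 i else y 0 j.
  have [ay by_] : a y = a y' /\ b y = b y'.
    by apply: indep => j ji; rewrite mxE (negPf ji).
  have xy' j : `|x 0 j - y' 0 j| <= d.
    rewrite mxE; case: eqP => [->|/eqP/xy //]; by rewrite subrr normr0 ltW.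
  have {}ua : `|a x - a y| <= e.
    by rewrite ay; apply: ua => // j; apply: le_trans (xy' j) _; rewrite ge_min lexx.
  have {}ub : `|b x - b y| <= e.
    by rewrite by_; apply: ub => // j; apply: le_trans (xy' j) _; rewrite ge_min lexx orbT.
  have E : a x * (x 0 i - y 0 i) = - (b x - b y) - (a x - a y) * y 0 i.
    transitivity (a x * (x 0 i - y 0 i) - (a x * x 0 i + b x) + (a y * y 0 i + b y)).
      by rewrite xE yE subr0 addr0.
    ring.
  have hE : h = M * (e + e * M).
    by rewrite /e; field; rewrite !lt0r_neq0 // addr_gt0.
  rewrite hE; apply: (@le_trans _ _ (M * `|a x| * `|x 0 i - y 0 i|)).
    by rewrite ler_peMl.
  rewrite -mulrA -normrM E; apply: ler_wpM2l; first exact: ltW.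
  apply: (le_trans (ler_normB _ _)); rewrite normrN lerD // normrM.
  by apply: ler_pM.
pose inc (c : {ffun 'I_N -> 'I_q}) (x : 'rV[R]_N) := forall j, j != i ->
  - M + 2 * M * ((c j)%:R / q%:R) <= x 0 j <= - M + 2 * M * ((c j).+1%:R / q%:R).
(* A reference point of [S] over the cell [c], or 0 if there is none. It does not depend on [c i],
   which only cuts the interval of length 2 h around its coordinate [i] into q pieces, so that all
   coordinates are indexed alike. *)
pose yc c : 'rV[R]_N := xget 0 [set y | S y /\ inc c y].
pose lo c j : R := if j == i then yc c 0 i - h else - M.
pose w j : R := if j == i then 2 * h else 2 * M.
exists {ffun 'I_N -> 'I_q}, (fun c => \row_j (lo c j + w j * ((c j)%:R / q%:R))),
  (fun c => \row_j (lo c j + w j * ((c j).+1%:R / q%:R))); split.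
- move=> c j; rewrite !mxE lerD2l ler_wpM2l //.
    by rewrite /w; case: eqP => _; rewrite mulr_ge0 // ltW.
  by rewrite ler_wpM2r ?invr_ge0 // ler_nat.
- move=> x Sx.
  have [c1 c1P] : exists c1 : {ffun 'I_N -> 'I_q}, inc c1 x.
    have cell j : {c : 'I_q |
        - M + 2 * M * (c%:R / q%:R) <= x 0 j <= - M + 2 * M * (c.+1%:R / q%:R)}.
      apply: cid; apply: grid_cell => //.
      by have := (let: And3 xM _ _ := Sx in xM j); rewrite ler_norml; lra.
    by exists [ffun j => sval (cell j)] => j _; rewrite ffunE; case: (cell j).
  have [Sy yin] : S (yc c1) /\ inc c1 (yc c1).
    by apply: (@xgetPex _ 0 [set y | S y /\ inc c1 y]); exists x.
  have xy : `|x 0 i - yc c1 0 i| <= h.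
    apply: close => // j ji; move: (c1P j ji) (yin j ji).
    set l := _ * (_%:R / _); set u := _ * (_%:R / _) => xl yl.
    apply: le_trans qd; rewrite ler_norml.
    have -> : 2 * M / q%:R = u - l.
      rewrite /u /l -natr1; field; exact: lt0r_neq0.
    by lra.
  have [ci ciP] : exists ci : 'I_q, yc c1 0 i - h + 2 * h * (ci%:R / q%:R) <= x 0 i
      <= yc c1 0 i - h + 2 * h * (ci.+1%:R / q%:R).
    by apply: grid_cell => //; move: xy; rewrite ler_norml; lra.
  pose c := [ffun j => if j == i then ci else c1 j].
  have ycE : yc c = yc c1.
    congr (xget 0 _); apply/seteqP; split => y [Sy' yi]; split => // j ji;
      by have := yi j ji; rewrite ffunE (negPf ji).
  exists c => // j; rewrite !mxE /lo /w /c ffunE -/c ycE.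
  by case: eqP => [-> //|/eqP ji]; apply: c1P.
under eq_bigr => c _.
  under eq_bigr => j _ do rewrite !mxE opprD addrACA subrr add0r -mulrBr -mulrBl
    -natr1 addrAC subrr add0r.
  over.
(* Each of the q^N boxes has as volume the product of the [w j / q], so the total is the product of
   the [w j], namely 2 h W = eps. *)
rewrite sumr_const card_ffun !card_ord -[_ *+ _]mulr_natr natrX.
rewrite big_split /= prodr_const card_ord -mulrA -exprMn div1r mulVf ?pnatr_eq0 //.
rewrite expr1n mulr1 (bigD1 i) //= /w eqxx (eq_bigr (fun=> 2 * M)); last first.
  by move=> j /negPf ->.
by have -> : 2 * h * W = eps by rewrite /h; field; rewrite lt0r_neq0.
Qed.

(** The bounded pieces with M = 1, 2, ... exhaust the set: M need only exceed the inverse of [|a x|]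
    and every [|x 0 j|]. *)
Lemma measure_zero_graph (N : nat) (i : 'I_N) (a b : 'rV[R]_N -> R) :
  continuous a -> continuous b ->
  (forall x y : 'rV[R]_N, (forall j, j != i -> x 0 j = y 0 j) ->
     a x = a y /\ b x = b y) ->
  measure_zero [set x : 'rV[R]_N | a x != 0 /\ a x * x 0 i + b x = 0].
Proof.
move=> ca cb indep.
apply: measure_zero_sub; last first.
  apply: measure_zero_bigcup => m.
  by apply: (@measure_zero_graph_cube _ i a b m.+1%:R _ ca cb indep); rewrite ler1n.
move=> x [ax0 xE].
pose B := `|a x|^-1 + \sum_j `|x 0 j|.
have B0 : 0 <= B by rewrite addr_ge0 ?invr_ge0 // sumr_ge0.
have Bm : B <= (Num.truncn B).+1%:R by apply/ltW/truncnS_gt.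
exists (Num.truncn B) => //; split => //.
  move=> j; apply: le_trans Bm; rewrite /B (bigD1 j) //= addrCA lerDl.
  by rewrite addr_ge0 ?invr_ge0 // sumr_ge0.
rewrite -ler_pdivrMr ?normr_gt0 // div1r; apply: le_trans Bm.
by rewrite lerDl sumr_ge0.
Qed.

Lemma measure_zero_setU (N : nat) (Z Z' : set 'rV[R]_N) :
  measure_zero Z -> measure_zero Z' -> measure_zero (Z `|` Z').
Proof.
move=> Z0 Z'0; apply: measure_zero_sub (@measure_zero_bigcup N
  (fun m => if m == 0%N then Z else Z') _); last by case.
by move=> x [Zx|Zx]; [exists 0%N|exists 1%N].
Qed.

Lemma measure_zero_exists (N : nat) (I : finType) (i0 : I) (Z : I -> set 'rV[R]_N) :
  (forall i, measure_zero (Z i)) -> measure_zero [set x | exists i, Z i x].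
Proof.
move=> Z0; apply: measure_zero_sub (@measure_zero_bigcup N
  (fun m => Z (nth i0 (enum I) m)) _) => // x [i Zi].
by exists (index i (enum I)) => //; rewrite nth_index // mem_enum.
Qed.

End NullSets.

(** * Directed-cycle models *)

Lemma size_index_enum_ord (n : nat) : size (index_enum 'I_n) = n.
Proof. by rewrite -sum1_size sum1_card card_ord. Qed.

Section CycleModel.
Variables (R : realType) (n : nat) (M : model n).
Hypotheses (n_gt1 : (1 < n)%N) (hM : directed_cycle M).
Implicit Types k : params R M.

Lemma edges_cycle (u v : 'I_n) : ((u, v) \in edges M) = (v == ordS u).
Proof.
rewrite hM; apply/imsetP/eqP => [[w _ [-> ->]] //|->]; by exists u.
Qed.

Lemma cycle_edge (v : 'I_n) : (v, ordS v) \in edges M.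
Proof. by rewrite edges_cycle. Qed.

Definition rate k (v : 'I_n) : R := edge_param k (ordS v) v.

Definition outflow k (v : 'I_n) : R := leak_param k v + rate k v.

(** The coordinates of the parameter vector that hold k_v and, below, the leak rate of [l]. *)
Definition rate_index (v : 'I_n) : 'I_#|param_index M| :=
  enum_rank (inl (exist _ (v, ordS v) (cycle_edge v)) : param_index M).

Definition leak_index (l : 'I_n) (lL : l \in leaks M) : 'I_#|param_index M| :=
  enum_rank (inr (exist _ l lL) : param_index M).

Lemma rateE k v : rate k v = k 0 (rate_index v).
Proof.
rewrite /rate /edge_param insubT; first exact: cycle_edge.
by move=> e; congr (k 0 (enum_rank (inl _))); apply: val_inj.
Qed.

Lemma leak_paramE k l (lL : l \in leaks M) : leak_param k l = k 0 (leak_index lL).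
Proof.
rewrite /leak_param insubT.
by congr (k 0 (enum_rank (inr _))); apply: val_inj.
Qed.

Lemma leak_param0 k l : l \notin leaks M -> leak_param k l = 0.
Proof. by move=> lL; rewrite /leak_param insubN. Qed.

Lemma param_indexP (m : 'I_#|param_index M|) :
  (exists v, m = rate_index v) \/ (exists l lL, m = @leak_index l lL).
Proof.
rewrite -[m]enum_valK; case: (enum_val m) => [[[u v] e]|[l lL]].
- left; have := e; rewrite edges_cycle => /eqP ve; exists u.
  by congr (enum_rank (inl _)); apply: val_inj; rewrite /= ve.
- by right; exists l, lL.
Qed.

Lemma params_ext k k' : rate k =1 rate k' ->
  (forall l, l \in leaks M -> leak_param k l = leak_param k' l) -> k = k'.
Proof.
move=> hr hl; apply/rowP => m.
have [[v ->]|[l [lL ->]]] := param_indexP m; first by rewrite -!rateE.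
by rewrite -!leak_paramE hl.
Qed.

Definition mk_params (f g : 'I_n -> R) : params R M :=
  \row_m match enum_val m with inl e => f (val e).1 | inr l => g (val l) end.

Lemma rate_mk f g v : rate (mk_params f g) v = f v.
Proof. by rewrite rateE mxE enum_rankK. Qed.

Lemma leak_mk f g l : l \in leaks M -> leak_param (mk_params f g) l = g l.
Proof. by move=> lL; rewrite leak_paramE mxE enum_rankK. Qed.

Lemma continuous_rate v : continuous (fun k => rate k v).
Proof.
rewrite (_ : (fun k => rate k v) = (fun k => k 0 (rate_index v))).
  exact: coord_continuous.
by apply/funext => k; rewrite rateE.
Qed.

Lemma continuous_leak_param v : continuous (fun k => leak_param k v).
Proof.
have [vL|vL] := boolP (v \in leaks M).
  rewrite (_ : (fun k => _) = (fun k => k 0 (leak_index vL))).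
    exact: coord_continuous.
  by apply/funext => k; rewrite leak_paramE.
rewrite (_ : (fun k => _) = (fun k => 0)); first exact: cst_continuous.
by apply/funext => k; rewrite leak_param0.
Qed.

Lemma continuous_outflow v : continuous (fun k => outflow k v).
Proof.
move=> k; exact: (cvgD (@continuous_leak_param v k) (@continuous_rate v k)).
Qed.

(** The diagonal is written as ['X] minus a constant so that the facts about products of such monic
    linear factors apply. *)
Lemma char_poly_mx_cycle k : char_poly_mx (compartmental_matrix k) =
  cyclic_mx (fun v => 'X - (- outflow k v)%:P) (fun v => (rate k v)%:P).
Proof.
apply/matrixP => i j; rewrite !mxE; have [_|ij] := eqVneq i j.
  rewrite mulr1n; congr (_ - _%:P); rewrite /outflow opprD; congr (_ - _).
  rewrite (eq_bigl (pred1 (ordS i))) ?big_pred1_eq // => v.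
  by rewrite edges_cycle.
rewrite mulr0n sub0r; case: eqP => [->|/eqP ij']; first by [].
by rewrite /edge_param insubN ?oppr0 // edges_cycle.
Qed.

Lemma prod_XsubC_neqC k (c : R) :
  \prod_v ('X - (- outflow k v)%:P) != c%:P.
Proof.
apply/eqP => /(congr1 (fun p : {poly R} => size p)).
by rewrite size_prod_XsubC size_index_enum_ord size_polyC; case: (_ == _); lia.
Qed.

Lemma output_polyE k : output_poly k =
  \prod_v ('X - (- outflow k v)%:P) - (\prod_v rate k v)%:P.
Proof.
by rewrite /output_poly char_poly_mx_cycle det_cyclic_mx // rmorph_prod.
Qed.

Lemma input_polyE k i j : input_poly k i j =
  (path_prod (rate k) j i)%:P *
    off_path_prod (fun v => 'X - (- outflow k v)%:P) j i.
Proof.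
rewrite /input_poly char_poly_mx_cycle cofactor_cyclic_mx //; last first.
  by rewrite -rmorph_prod prod_XsubC_neqC.
by rewrite /path_prod rmorph_prod.
Qed.

Lemma size_output_poly k : (size (output_poly k) <= n.+1)%N.
Proof.
rewrite output_polyE; apply: (leq_trans (size_polyD _ _)).
rewrite size_prod_XsubC size_index_enum_ord geq_max leqnn size_polyN size_polyC.
by case: (_ == _).
Qed.

(** The vertex [i] is not off the path, so at most n - 1 linear factors occur. *)
Lemma size_input_poly k i j : (size (input_poly k i j) <= n)%N.
Proof.
rewrite input_polyE mul_polyC; apply: (leq_trans (size_scale_leq _ _)).
rewrite /off_path_prod -big_filter size_prod_XsubC size_filter.
rewrite -[X in (_ <= X)%N](size_index_enum_ord n).
rewrite -(count_predC (fun v => cycle_dist j i < cycle_dist j v)%N).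
rewrite -addn1 leq_add2l -has_count; apply/hasP.
by exists i; [exact: mem_index_enum|rewrite /= ltnn].
Qed.

(** By the two size bounds, the finitely many listed coefficients determine the polynomials; from
    here on only polynomial identities are used. *)
Lemma coefficient_mapP k k' : coefficient_map k = coefficient_map k' <->
  output_poly k = output_poly k' /\
  (forall i j, i \in outputs M -> j \in inputs M -> input_poly k i j = input_poly k' i j).
Proof.
split => [h|[ho hi]].
  have {h} h' x : io_coefficient k x = io_coefficient k' x.
    by move: h => /rowP/(_ (enum_rank x)); rewrite !mxE enum_rankK.
  split.
    have [i iO] := card_gt0P (outputs_gt0 M).
    apply/polyP => d; have [dn|dn] := ltnP d n.+1; last first.
      by rewrite !(nth_default _ (leq_trans (size_output_poly _) dn)).
    exact: (h' (exist _ i iO, inl (Ordinal dn))).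
  move=> i j iO jI; apply/polyP => d; have [dn|dn] := ltnP d n; last first.
    by rewrite !(nth_default _ (leq_trans (size_input_poly _ _ _) dn)).
  exact: (h' (exist _ i iO, inr (exist _ j jI, Ordinal dn))).
apply/rowP => m; rewrite !mxE; case: (enum_val m) => [[i iO] [d|[[j jI] d]]] /=.
  by rewrite ho.
by rewrite hi.
Qed.

End CycleModel.

Lemma cvg_prodr (R : realType) (T : Type) (F : set_system T) {FF : Filter F}
    (I : Type) (r : seq I) (P : pred I) (f : I -> T -> R) (l : I -> R) :
  (forall i, P i -> f i x @[x --> F] --> l i) ->
  \prod_(i <- r | P i) f i x @[x --> F] --> \prod_(i <- r | P i) l i.
Proof. by apply: cvg_big; exact: mul_continuous. Qed.

(** * Generic parameter vectors *)

Section Genericity.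
Variables (R : realType) (n : nat) (M : model n).
Hypotheses (n_gt1 : (1 < n)%N) (hM : directed_cycle M).
Implicit Types k : params R M.

(* Two generic parameter vectors close to each other satisfy [apart k k']; the *)
(* last condition says that - outflow k v is a simple root of the polynomial   *)
(* prod_u (X + outflow k u) - (prod_(u <> v) rate k u) (X + outflow k v).      *)
Definition apart k k' : Prop :=
  [/\ forall u, rate k u != 0,
      forall u w, u != w -> outflow k u - outflow k' w != 0 &
      forall v, \prod_(u | u != v) (outflow k u - outflow k' v) -
                \prod_(u | u != v) rate k u != 0].

(** Each clause says that finitely many continuous functions of the pair do not vanish, so it
    persists near [(k0, k0)]; a product neighbourhood there is then intersected down to one [U]. *)
Lemma apart_nbhs k0 : apart k0 k0 ->
  exists U : set (params R M), nbhs k0 U /\ forall k k', U k -> U k' -> apart k k'.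
Proof.
move=> [rate0 outflow0 simple0].
have rate1 u : rate p.1 u @[p --> (k0, k0)] --> rate k0 u.
  exact: (@cvg_comp _ _ _ fst (fun k => rate k u) _ _ _ (@cvg_fst _ _ _ _ _)
    (@continuous_rate _ _ _ hM u k0)).
have outflow1 u : outflow p.1 u @[p --> (k0, k0)] --> outflow k0 u.
  exact: (@cvg_comp _ _ _ fst (fun k => outflow k u) _ _ _ (@cvg_fst _ _ _ _ _)
    (@continuous_outflow _ _ _ hM u k0)).
have outflow2 u : outflow p.2 u @[p --> (k0, k0)] --> outflow k0 u.
  exact: (@cvg_comp _ _ _ snd (fun k => outflow k u) _ _ _ (@cvg_snd _ _ _ _ _)
    (@continuous_outflow _ _ _ hM u k0)).
have : \forall p \near (k0, k0), apart p.1 p.2.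
  have n1 : \forall p \near (k0, k0), forall u, rate p.1 u != 0.
    by apply: (filter_forall (nbhs_filter (k0, k0))) => u; apply: cvgr_neq0 (rate1 u) (rate0 u).
  have n2 : \forall p \near (k0, k0), forall uw : 'I_n * 'I_n,
      uw.1 != uw.2 -> outflow p.1 uw.1 - outflow p.2 uw.2 != 0.
    apply: (filter_forall (nbhs_filter (k0, k0))) => -[u w] /=; have [->|uw] := eqVneq u w.
      exact: nearW.
    apply: (@filterS _ (nbhs (k0, k0)) (nbhs_filter _) _ _ (fun p hp _ => hp)).
    exact: (cvgr_neq0 _ (cvgB (outflow1 u) (outflow2 w)) (outflow0 _ _ uw)).
  have n3 : \forall p \near (k0, k0), forall v,
      \prod_(u | u != v) (outflow p.1 u - outflow p.2 v) -
      \prod_(u | u != v) rate p.1 u != 0.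
    apply: (filter_forall (nbhs_filter (k0, k0))) => v; apply: cvgr_neq0 (simple0 v).
    apply: cvgB; apply: cvg_prodr => u _; last exact: rate1.
    exact: (cvgB (outflow1 u) (outflow2 v)).
  apply: filterS3 n1 n2 n3 => p h1 h2 h3; split => // u w uw.
  exact: (h2 (u, w)).
move=> [[A B] /= [nA nB] AB]; exists (A `&` B); split; first exact: filterI.
by move=> k k' [Ak _] [_ Bk']; apply: (AB (k, k')).
Qed.

Lemma measure_zero_rate_graph (u : 'I_n) (a b : params R M -> R) :
  continuous a -> continuous b ->
  (forall k k', (forall w, w != u -> rate k w = rate k' w) ->
     (forall l, leak_param k l = leak_param k' l) -> a k = a k' /\ b k = b k') ->
  measure_zero [set k | a k != 0 /\ a k * rate k u + b k = 0].
Proof.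
move=> ca cb indep.
have := @measure_zero_graph R _ (rate_index hM u) a b ca cb _.
under eq_set do rewrite -rateE; apply=> x y xy; apply: indep.
  move=> w wu; rewrite !(rateE hM); apply: xy.
  by rewrite (inj_eq enum_rank_inj); apply: contraNneq wu => -[->].
move=> l; have [lL|lL] := boolP (l \in leaks M); last by rewrite !leak_param0.
rewrite !(leak_paramE _ lL); apply: xy.
by apply/eqP => /enum_rank_inj.
Qed.

Lemma measure_zero_rate_hyperplane (u : 'I_n) (b : params R M -> R) : continuous b ->
  (forall k k', (forall w, w != u -> rate k w = rate k' w) ->
     (forall l, leak_param k l = leak_param k' l) -> b k = b k') ->
  measure_zero [set k | rate k u + b k = 0].
Proof.
move=> cb indep.
apply: measure_zero_sub (@measure_zero_rate_graph u (fun=> 1) b _ cb _) => //.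
- by move=> k /= h; rewrite mul1r oner_neq0.
- exact: cst_continuous.
- by move=> k k' h1 h2; rewrite (indep k k').
Qed.

(** Each way to fail is an affine equation in a single rate: [Z1] is a vanishing rate, [Z2] a
    coincidence of outflows, [Z3] a multiple root with non-zero leading coefficient in rate [u], and
    [Z4] covers the case where that coefficient vanishes. *)
Lemma measure_zero_not_apart : measure_zero [set k | ~ apart k k].
Proof.
have i0 : 'I_n by exists 0%N; lia.
pose A (u v : 'I_n) k := \prod_(w | (w != v) && (w != u)) (outflow k w - outflow k v).
pose B (u v : 'I_n) k := \prod_(w | (w != v) && (w != u)) rate k w.
have cA u v : continuous (A u v).
  move=> k; apply: (@cvg_prodr _ _ _ (nbhs_filter k)) => w _.
  exact: (cvgB (@continuous_outflow _ _ _ hM w k) (@continuous_outflow _ _ _ hM v k)).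
have cB u v : continuous (B u v).
  by move=> k; apply: (@cvg_prodr _ _ _ (nbhs_filter k)) => w _; exact: continuous_rate.
have clo u v : continuous (fun k => leak_param k u - outflow k v).
  move=> k; exact: (cvgB (@continuous_leak_param _ _ _ u k) (@continuous_outflow _ _ _ hM v k)).
have out_indep u v k k' : v != u -> (forall w, w != u -> rate k w = rate k' w) ->
    (forall l, leak_param k l = leak_param k' l) -> outflow k v = outflow k' v.
  by move=> vu hr hl; rewrite /outflow hl hr.
have AB_indep u v k k' : v != u -> (forall w, w != u -> rate k w = rate k' w) ->
    (forall l, leak_param k l = leak_param k' l) -> A u v k = A u v k' /\ B u v k = B u v k'.
  move=> vu hr hl; split; apply: eq_bigr => w /andP[wv wu]; last exact: hr.
  by congr (_ - _); apply: (out_indep u).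
pose Z1 (u : 'I_n) : set (params R M) := [set k | rate k u + 0 = 0].
pose Z2 (p : 'I_n * 'I_n) : set (params R M) := [set k | p.1 != p.2 /\
  rate k p.1 + (leak_param k p.1 - outflow k p.2) = 0].
pose Z3 (p : 'I_n * 'I_n) : set (params R M) := [set k | p.2 != p.1 /\
  ((A p.1 p.2 k - B p.1 p.2 k != 0) /\ (A p.1 p.2 k - B p.1 p.2 k) * rate k p.1 +
    (leak_param k p.1 - outflow k p.2) * A p.1 p.2 k = 0)].
pose Z4 (p : 'I_n * 'I_n) : set (params R M) :=
  [set k | rate k p.2 + (leak_param k p.2 - leak_param k p.1) = 0].
have mZ1 u : measure_zero (Z1 u).
  by apply: measure_zero_rate_hyperplane => //; exact: cst_continuous.
have m0 (C : Prop) : ~ C -> forall Z : set (params R M),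
    measure_zero [set k | C /\ Z k].
  by move=> nC Z; apply: measure_zero_sub (mZ1 i0) => k [].
have mC (C : Prop) (Z : set (params R M)) : (C -> measure_zero Z) ->
    measure_zero [set k | C /\ Z k].
  move=> h; have [cC|nC] := pselect C; last exact: m0.
  by apply: measure_zero_sub (h cC) => k [].
have mZ2 p : measure_zero (Z2 p).
  apply: mC => pp; apply: measure_zero_rate_hyperplane => [|k k' hr hl].
    exact: clo.
  by rewrite hl (out_indep p.1 p.2 k k') // eq_sym.
have mZ3 p : measure_zero (Z3 p).
  apply: mC => pp; apply: measure_zero_rate_graph => [k|k|k k' hr hl].
  - exact: (cvgB (cA p.1 p.2 k) (cB p.1 p.2 k)).
  - exact: (cvgM (clo p.1 p.2 k) (cA p.1 p.2 k)).
  - have [-> ->] := AB_indep p.1 p.2 k k' pp hr hl.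
    by rewrite hl (out_indep p.1 p.2 k k').
have mZ4 p : measure_zero (Z4 p).
  apply: measure_zero_rate_hyperplane => [k|k k' hr hl]; last by rewrite !hl.
  exact: (cvgB (@continuous_leak_param _ _ _ p.2 k) (@continuous_leak_param _ _ _ p.1 k)).
apply: measure_zero_sub (measure_zero_setU (measure_zero_exists i0 mZ1)
  (measure_zero_setU (measure_zero_exists (i0, i0) mZ2)
  (measure_zero_setU (measure_zero_exists (i0, i0) mZ3)
     (measure_zero_exists (i0, i0) mZ4)))) => k nk.
apply: contrapT => /not_orP[n1 /not_orP[n2 /not_orP[n3 n4]]]; apply: nk.
have r0 u : rate k u != 0.
  by apply/eqP => e; apply: n1; exists u; rewrite /Z1 /= addr0.
have o0 u w : u != w -> outflow k u - outflow k w != 0.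
  move=> uw; apply/eqP => e; apply: n2; exists (u, w); split => //=.
  by rewrite -e /outflow; ring.
split => // v; apply/eqP => e.
have [u uv] : exists u, u != v.
  exists (ordS v); apply/eqP => /(congr1 (@nat_of_ord n)); rewrite val_ordS.
  by case: ifP; lia.
have E : (A u v k - B u v k) * rate k u + (leak_param k u - outflow k v) * A u v k = 0.
  rewrite -e [in RHS](bigD1 u) //= [X in _ = _ - X](bigD1 u) //= /A /B /outflow; ring.
(* If the coefficient of rate [u] vanishes, the constant term must vanish too. Its factor [A u v k]
   is non-zero because the outflows are distinct, so the leak rate of [u] equals the outflow of [v],
   an affine equation in rate [v]. *)
have [AB|AB] := eqVneq (A u v k - B u v k) 0; last first.
  by apply: n3; exists (u, v); split => //=; rewrite eq_sym.
move: E; rewrite AB mul0r add0r => /eqP; rewrite mulf_eq0 => /orP[/eqP lv|]; last first.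
  by apply/negP; apply/prodf_neq0 => w /andP[wv _]; exact: o0.
apply: n4; exists (u, v) => /=; apply/eqP; rewrite -oppr_eq0 -lv /outflow.
by apply/eqP; ring.
Qed.

End Genericity.

(** * Leak segments *)

Section LeakSegments.
Variables (n : nat) (L : {set 'I_n}).

(** As [enum L] is increasing, no leak lies strictly between [l] and the next entry; past the last
    entry the order wraps around to the first. *)
Lemma next_closest (l v : 'I_n) : l \in L -> v \in L ->
  (cycle_dist (ordS l) (next (enum L) l) <= cycle_dist (ordS l) v)%N.
Proof.
move=> lL vL.
have srt : sorted (fun a b : 'I_n => (a <= b)%N) (enum L).
  rewrite /enum_mem -enumT; apply: sorted_filter; first by move=> a b c; apply: leq_trans.
  by have := iota_sorted 0 n; rewrite -val_enum_ord sorted_map.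
rewrite next_nth mem_enum lL.
have ls : l \in enum L by rewrite mem_enum.
have vs : v \in enum L by rewrite mem_enum.
case: (enum L) (enum_uniq L) ls vs srt => // y p uyp ls vs srt.
have lE := nth_index y ls; have vE := nth_index y vs.
have ltl : (index l (y :: p) < size (y :: p))%N by rewrite index_mem.
have ltv : (index v (y :: p) < size (y :: p))%N by rewrite index_mem.
move: (index l (y :: p)) (index v (y :: p)) lE vE ltl ltv => i j lE vE ltl ltv.
have mono (a b : nat) : (a <= b)%N -> (b < size (y :: p))%N ->
    (nth y (y :: p) a <= nth y (y :: p) b)%N.
  move=> ab bs; apply: (@sorted_leq_nth _ (fun a b : 'I_n => (a <= b)%N)) => //=.
  - by move=> c d e; apply: leq_trans.
  - by rewrite inE; apply: leq_ltn_trans bs.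
have [ip|ip] := ltnP i (size p).
  have lx : (l <= nth y p i)%N by rewrite -lE; apply: (mono i i.+1).
  have lxn : l != nth y p i.
    by rewrite -[nth y p i]/(nth y (y :: p) i.+1) -lE nth_uniq //; lia.
  have vle : (v <= l)%N \/ (nth y p i <= v)%N.
    have [ji|ij] := leqP j i; [left|right]; first by rewrite -lE -vE mono.
    by rewrite -[nth y p i]/(nth y (y :: p) i.+1) -vE mono.
  move: (nth y p i) lx lxn vle => x lx; rewrite -val_eqE /= => lxn vle.
  rewrite !cycle_distE; move: (ordS l) (val_ordS l) => c; move: (ltn_ord x) (ltn_ord v) (ltn_ord l).
  by do 3!case: ifP; lia.
(* Here [l] is the last leak, and the default value [y] of [nth] is the first one. *)
rewrite nth_default //.
have yv : (y <= v)%N by rewrite -vE; apply: (mono 0%N).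
have ji : (j <= i)%N by apply: leq_trans ip; rewrite -ltnS.
have vl : (v <= l)%N by rewrite -vE -lE mono.
rewrite !cycle_distE; move: (ordS l) (val_ordS l) => c; move: (ltn_ord y) (ltn_ord v) (ltn_ord l).
by do 3!case: ifP; lia.
Qed.

Lemma segment_leak (l v : 'I_n) : l \in L -> v \in L ->
  v \in cycle_segment (ordS l) (next (enum L) l) -> v = next (enum L) l.
Proof.
move=> lL vL; rewrite inE => vs; apply: (@cycle_dist_inj _ (ordS l)).
by apply/eqP; rewrite eqn_leq next_closest // andbT.
Qed.

(** From l + 1 the vertex [w] comes no later than [l'], and from l' + 1 no later than [l]; for
    distinct leaks these two arcs are disjoint. *)
Lemma segment_disjoint (l l' w : 'I_n) : l \in L -> l' \in L ->
  w \in cycle_segment (ordS l) (next (enum L) l) ->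
  w \in cycle_segment (ordS l') (next (enum L) l') -> l = l'.
Proof.
move=> lL l'L; rewrite !inE -!/(cycle_dist _ _) => wl wl'.
have := leq_trans wl (next_closest lL l'L).
have := leq_trans wl' (next_closest l'L lL).
rewrite !cycle_distE => h h'; apply: val_inj; move: h h'.
move: (ordS l) (ordS l') (val_ordS l) (val_ordS l') => c c'.
move: (ltn_ord l) (ltn_ord l') (ltn_ord w) => /=.
by do 6!case: ifP; lia.
Qed.

End LeakSegments.

Lemma path_prod_ordS (T : comNzRingType) (n : nat) (r : 'I_n -> T) (j v : 'I_n) :
  ordS v != j -> path_prod r j (ordS v) = path_prod r j v * r v.
Proof.
move=> vj; rewrite /path_prod cycle_dist_ordS // (bigD1 v) //= mulrC; congr (_ * _).
apply: eq_bigl => w; rewrite ltnS [in RHS]ltn_neqAle andbC; congr (~~ _ && _).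
by apply/eqP/eqP => [->//|/cycle_dist_inj].
Qed.

(** * Ratios of two solutions as coboundaries *)

Section Ratios.
Variables (R : realType) (n : nat) (M : model n) (r : 'I_n -> R).
Hypotheses (r_neq0 : forall v, r v != 0)
  (r_leak : forall v, v \notin leaks M -> r v = 1)
  (r_prod : \prod_v r v = 1)
  (r_path : forall i j, i \in outputs M -> j \in inputs M -> path_prod r j i = 1).

(** A potential for [r]. Starting the product at vertex 0 is harmless: [r_prod] makes it consistent
    when the cycle closes. *)
Let g (v : 'I_n) := \prod_(u < n | (u < v)%N) r u.

Let g_ordS v : g (ordS v) = g v * r v.
Proof.
rewrite /g val_ordS; case: ifP => vn.
  rewrite (bigD1 v) //= mulrC; congr (_ * _); apply: eq_bigl => w.
  by rewrite ltnS ltn_neqAle andbC.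
rewrite big_pred0 // -[LHS]r_prod (bigD1 v) //= mulrC; congr (_ * _).
apply: eq_bigl => w; rewrite -val_eqE /=.
by move: (ltn_ord w) (ltn_ord v); lia.
Qed.

Let g_path j i : path_prod r j i * g j = g i.
Proof.
elim/(@cycle_ind n j): i => [|v vj IH].
  by rewrite /path_prod cycle_distxx big_pred0 // mul1r.
by rewrite path_prod_ordS // mulrAC IH g_ordS.
Qed.

(** The only leak in a segment is its end, so [r] is 1 at every earlier vertex and [g] does not
    change. *)
Let g_segment l v : l \in leaks M ->
  v \in cycle_segment (ordS l) (next (enum (leaks M)) l) -> g v = g (ordS l).
Proof.
move=> lL; elim/(@cycle_ind n (ordS l)): v => // v vl IH vs.
have vS : (cycle_dist (ordS l) v < cycle_dist (ordS l) (next (enum (leaks M)) l))%N.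
  by move: vs; rewrite inE -!/(cycle_dist _ _) cycle_dist_ordS.
rewrite g_ordS IH ?inE; last exact: ltnW.
rewrite r_leak ?mulr1 //; apply/negP => vL.
have := segment_leak lL vL; rewrite inE => /(_ (ltnW vS)) vE.
by move: vS; rewrite vE ltnn.
Qed.

(** With one leak, [r_prod] suffices. Otherwise [r_path] makes [g] constant on inputs and outputs,
    hence equal on all segments. A leak [v] ends one segment and [ordS v] starts the next, so [r v]
    is a quotient of equal values. *)
Lemma ratios_eq1 :
  (#|leaks M| <= 1)%N \/ (forall l, l \in leaks M ->
    cycle_segment (ordS l) (next (enum (leaks M)) l)
        :&: (inputs M :|: outputs M) != finset.set0) ->
  forall v, r v = 1.
Proof.
move=> h v; have [vL|/r_leak //] := boolP (v \in leaks M).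
case: h => [L1|inter].
  rewrite -[RHS]r_prod (bigD1 v) //= big1 ?mulr1 // => u uv.
  rewrite r_leak //; apply: contraNN uv => uL.
  by apply/eqP; apply: (card_le1_eqP L1).
have [j0 j0I] := card_gt0P (inputs_gt0 M).
have [i0 i0O] := card_gt0P (outputs_gt0 M).
have gio w : w \in inputs M :|: outputs M -> g w = g i0.
  have gI j : j \in inputs M -> g j = g i0.
    by move=> jI; rewrite -(g_path j i0) r_path // mul1r.
  rewrite inE => /orP[/gI //|wO].
  by rewrite -(g_path j0 w) r_path // mul1r gI.
have gS l : l \in leaks M -> g (ordS l) = g i0.
  move=> lL; have /set0Pn[w] := inter l lL; rewrite inE => /andP[ws wio].
  by rewrite -(g_segment lL ws) gio.
have gv : g v = g i0.
  have pL : prev (enum (leaks M)) v \in leaks M by rewrite -mem_enum mem_prev mem_enum.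
  rewrite -(gS _ pL); apply: g_segment => //.
  by rewrite next_prev ?enum_uniq // inE.
have := g_ordS v; rewrite gS // gv => /eqP.
rewrite -subr_eq0 -{1}(mulr1 (g i0)) -mulrBr mulf_eq0 subr_eq0.
have g0 : g i0 != 0 by apply/prodf_neq0.
by rewrite (negPf g0) => /eqP <-.
Qed.

End Ratios.

(** * Interlacing implies identifiability *)

Section Identifiable.
Variables (R : realType) (n : nat) (M : model n).
Hypotheses (n_gt1 : (1 < n)%N) (hM : directed_cycle M).
Implicit Types k : params R M.

Lemma horner_prod_outflow k (P : pred 'I_n) (x : R) :
  (\prod_(v | P v) ('X - (- outflow k v)%:P)).[- x] = \prod_(v | P v) (outflow k v - x).
Proof.
rewrite horner_prod; apply: eq_bigr => v _.
by rewrite hornerXsubC opprK addrC.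
Qed.

Lemma rate_nonleak k v : v \notin leaks M -> rate k v = outflow k v.
Proof. by move=> vL; rewrite /outflow leak_param0 // add0r. Qed.

(** Equal rate products leave two monic polynomials with the same roots, and [apart] excludes any
    non-trivial matching of them. *)
Lemma outflow_eq k k' : apart k k' -> output_poly k = output_poly k' ->
  \prod_v rate k v = \prod_v rate k' v -> outflow k =1 outflow k'.
Proof.
move=> [_ apt _]; rewrite !output_polyE // => h e; move: h; rewrite e => /addIr h w.
have : (\prod_v ('X - (- outflow k v)%:P)).[- outflow k' w] = 0.
  by rewrite h horner_prod_outflow (bigD1 w) //= subrr mul0r.
rewrite horner_prod_outflow => /eqP/prodf_eq0[u _].
have [-> /eqP/subr0_eq //|uw] := eqVneq u w.
by rewrite (negPf (apt _ _ uw)).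
Qed.

(** The common rate product gives the outflows; then [ratios_eq1] applies to the quotients of rates,
    which are 1 off the leaks because rate and outflow coincide there. *)
Lemma params_eq k k' : apart k k' -> apart k' k ->
  coefficient_map k = coefficient_map k' ->
  \prod_v rate k v = \prod_v rate k' v ->
  (#|leaks M| <= 1)%N \/ (forall l, l \in leaks M ->
    cycle_segment (ordS l) (next (enum (leaks M)) l)
        :&: (inputs M :|: outputs M) != finset.set0) -> k = k'.
Proof.
move=> apt apt' /(coefficient_mapP n_gt1 hM)[ho hi] hp hL.
have ho' := outflow_eq apt ho hp.
have [r0 _ _] := apt; have [r0' _ _] := apt'.
have hr v : rate k' v / rate k v = 1.
  apply: (@ratios_eq1 _ _ M (fun v => rate k' v / rate k v)) => //.
  - by move=> u; rewrite mulf_neq0 ?invr_neq0.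
  - by move=> u uL; rewrite !rate_nonleak // -ho' divff // -rate_nonleak.
  - by rewrite prodf_div hp divff //; apply/prodf_neq0.
  move=> i j iO jI; have := hi i j iO jI; rewrite !input_polyE //.
  have -> : off_path_prod (fun v => 'X - (- outflow k' v)%:P) j i =
            off_path_prod (fun v => 'X - (- outflow k v)%:P) j i.
    by apply: eq_bigr => u _; rewrite ho'.
  have Q0 : off_path_prod (fun v => 'X - (- outflow k v)%:P) j i != 0.
    by rewrite /off_path_prod -big_filter monic_neq0 // monic_prod_XsubC.
  move=> /(mulIf Q0)/polyC_inj e.
  have p0 : path_prod (rate k) j i != 0 by apply/prodf_neq0.
  by rewrite /path_prod prodf_div -!/(path_prod _ _ _) -e divff.
have hr' : rate k =1 rate k'.
  by move=> v; apply/esym; apply: divr1_eq.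
apply: (params_ext hM) => // l lL.
by have := ho' l; rewrite /outflow hr' => /addIr.
Qed.

Lemma ord_pred_max (j v : 'I_n) : v != ord_pred j ->
  (cycle_dist j v < cycle_dist j (ord_pred j))%N.
Proof.
move=> vj; rewrite ltn_neqAle; apply/andP; split.
  by apply: contraNneq vj => /cycle_dist_inj ->.
by rewrite (cycle_dist_max (ord_predK j)); have := cycle_dist_lt j v; lia.
Qed.

(** The vertex [v = ord_pred j] is off the path, so the right-hand side vanishes at minus its
    outflow, which [apart] identifies in both models. There the left-hand side is minus the rate
    product. *)
Lemma rate_prod_eq k k' i j : apart k k' -> coefficient_map k = coefficient_map k' ->
  i \in outputs M -> j \in inputs M -> i != ord_pred j ->
  \prod_v rate k v = \prod_v rate k' v.
Proof.
move=> [r0 apt _] /(coefficient_mapP n_gt1 hM)[ho hi] iO jI ij.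
pose v := ord_pred j.
have iv := ord_pred_max ij.
have ev : outflow k v = outflow k' v.
  have : (input_poly k i j).[- outflow k' v] = 0.
    rewrite hi // input_polyE // hornerM /off_path_prod horner_prod_outflow.
    by rewrite [X in _ * X](bigD1 v) //= subrr mul0r mulr0.
  rewrite input_polyE // hornerM hornerC /off_path_prod horner_prod_outflow.
  move=> /eqP; rewrite mulf_eq0 => /orP[|/prodf_eq0[u _]].
    by move=> /prodf_eq0[u _]; rewrite (negPf (r0 u)).
  have [-> /eqP/subr0_eq //|uv] := eqVneq u v.
  by rewrite (negPf (apt _ _ uv)).
have := congr1 (fun p => p.[- outflow k v]) ho; rewrite !output_polyE // !hornerD !hornerN !hornerC.
rewrite !horner_prod_outflow [X in X - _](bigD1 v) //= [X in _ = X - _](bigD1 v) //=.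
by rewrite -ev subrr !mul0r !sub0r => /oppr_inj.
Qed.

Lemma path_prod_ord_pred (r : 'I_n -> R) (j : 'I_n) :
  path_prod r j (ord_pred j) = \prod_(u | u != ord_pred j) r u.
Proof.
apply: eq_bigl => u; apply/idP/idP => [|/ord_pred_max //].
by apply: contraTneq => ->; rewrite ltnn.
Qed.

Lemma input_poly_ord_pred k (j : 'I_n) :
  input_poly k (ord_pred j) j = (\prod_(u | u != ord_pred j) rate k u)%:P.
Proof.
rewrite input_polyE // path_prod_ord_pred /off_path_prod [X in _ * X]big_pred0 ?mulr1 // => v.
by rewrite (cycle_dist_max (ord_predK j)); have := cycle_dist_lt j v; lia.
Qed.

(* - outflow k v is a root of prod_u (X + outflow k u) - K (X + outflow k v),  *)
(* K := prod_(u <> v) rate k u, which the coefficients determine.              *)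
Lemma rate_prod_eq_pred k k' j : apart k k' -> coefficient_map k = coefficient_map k' ->
  j \in inputs M -> ord_pred j \in outputs M -> (#|leaks M| <= 1)%N ->
  \prod_v rate k v = \prod_v rate k' v.
Proof.
move=> [r0 _ simple] /(coefficient_mapP n_gt1 hM)[ho hi] jI vO L1.
have := hi _ _ vO jI; rewrite !input_poly_ord_pred => /polyC_inj.
move: (ord_pred j) simple {hi vO} => v /(_ v) simple eK.
pose K := \prod_(u | u != v) rate k u.
have E x : \prod_u (outflow k u - x) - \prod_u rate k u =
           \prod_u (outflow k' u - x) - \prod_u rate k' u.
  have := congr1 (fun p => p.[- x]) ho.
  by rewrite !output_polyE // !hornerD !hornerN !hornerC !horner_prod_outflow.
have pr k1 : \prod_u rate k1 u = rate k1 v * \prod_(u | u != v) rate k1 u.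
  by rewrite (bigD1 v).
have po k1 x : \prod_u (outflow k1 u - x) =
    (outflow k1 v - x) * \prod_(u | u != v) (outflow k1 u - x).
  by rewrite (bigD1 v).
(* If [v] is not a leak, its rate is its outflow, and evaluation at minus the outflow of [v] in [k']
   already exhibits the simple-root factor. *)
have [vL|vL] := boolP (v \in leaks M); last first.
  have := E (outflow k' v); rewrite (po k') subrr mul0r po !pr -eK -!/K !rate_nonleak //.
  move=> /eqP; rewrite -subr_eq0.
  rewrite (_ : _ - _ = (outflow k v - outflow k' v) *
    (\prod_(u | u != v) (outflow k u - outflow k' v) - K)); last by ring.
  by rewrite mulf_eq0 (negPf simple) orbF subr_eq0 => /eqP ->.
(* If [v] is the leak, the other outflows are rates, and evaluation at 0 expresses the difference of
   the rate products as K times the difference of the outflows of [v]. *)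
have prl k1 : \prod_(u | u != v) (outflow k1 u - 0) = \prod_(u | u != v) rate k1 u.
  apply: eq_bigr => u uv; rewrite subr0 rate_nonleak //.
  by apply: contraNN uv => uL; apply/eqP; apply: (card_le1_eqP L1).
have E0 := E 0; rewrite !po !prl -eK -!/K !subr0 in E0.
have := E (outflow k' v); rewrite (po k') subrr mul0r po => E1.
have : (outflow k v - outflow k' v) *
    (\prod_(u | u != v) (outflow k u - outflow k' v) - K) = 0.
  rewrite mulrBr; apply/eqP; rewrite subr_eq0; apply/eqP.
  by move: E0 E1; set a := _ * \prod_(_ | _) _; lra.
move=> /eqP; rewrite mulf_eq0 (negPf simple) orbF subr_eq0 => /eqP ev.
by move: E0; rewrite ev => /addrI/oppr_inj.
Qed.

(** The disjoint segments must each contain [j] or [ord_pred j], so there are at most two. If there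
    are two, these vertices are in different segments, so [ord_pred j] ends its segment and is a
    leak: the model is exceptional. *)
Lemma leak_interlacing_pred j : leak_interlacing M ->
  inputs M = [set j]%SET -> outputs M = [set ord_pred j]%SET -> (#|leaks M| <= 1)%N.
Proof.
move=> [nexc [//|[L2 inter]]] eI eO; exfalso; apply: nexc; exists j.
have segP l : l \in leaks M -> exists b : bool,
    (if b then j else ord_pred j) \in cycle_segment (ordS l) (next (enum (leaks M)) l).
  move=> /inter/set0Pn[w]; rewrite eI eO finset.in_setI finset.in_setU !finset.in_set1.
  by case/andP => ws /orP[/eqP we|/eqP we]; [exists true|exists false]; rewrite -we.
have /boolp.choice[b bP] : forall l, exists b : bool, l \in leaks M ->
    (if b then j else ord_pred j) \in cycle_segment (ordS l) (next (enum (leaks M)) l).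
  move=> l; have [lL|//] := boolP (l \in leaks M); last by exists true.
  by have [b bP] := segP l lL; exists b.
have binj : {in leaks M &, injective b}.
  move=> l l' lL l'L e; apply: (segment_disjoint lL l'L (bP _ lL)).
  by rewrite e; exact: bP.
have L2' : (#|leaks M| <= 2)%N.
  by rewrite -(card_in_imset binj) -card_bool max_card.
have cL : #|leaks M| = 2%N by apply/eqP; rewrite eqn_leq L2'.
have bsurj c : exists2 l, l \in leaks M & b l = c.
  have : c \in [set b l | l in leaks M]%SET.
    suff -> : [set b l | l in leaks M]%SET = [set: bool]%SET by rewrite inE.
    by apply/eqP; rewrite eqEcard finset.subsetT card_in_imset // cL cardsT card_bool.
  by case/imsetP => l lL ->; exists l.
split => //; apply/negPn/negP => pL.
have [l lL bl] := bsurj false; have [l' l'L bl'] := bsurj true.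
have := bP l lL; have := bP l' l'L; rewrite bl bl' => js ps.
have ll' : l = l'.
  apply: (segment_disjoint lL l'L _ js); move: ps; rewrite !inE -!/(cycle_dist _ _).
  rewrite leq_eqVlt => /orP[/eqP/cycle_dist_inj e|lt].
    by move: pL; rewrite e -mem_enum mem_next mem_enum lL.
  have [e|ne] := eqVneq j (ordS l); first by rewrite e cycle_distxx.
  by have := @cycle_dist_ordS _ (ordS l) (ord_pred j); rewrite ord_predK => /(_ ne) ->.
by move: bl bl'; rewrite ll' => ->.
Qed.

Lemma rate_prod_eq_interlacing k k' : leak_interlacing M -> apart k k' ->
  coefficient_map k = coefficient_map k' -> \prod_v rate k v = \prod_v rate k' v.
Proof.
move=> hL apt.
have [j jI] := card_gt0P (inputs_gt0 M).
have [i iO] := card_gt0P (outputs_gt0 M).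
have [[i' [j' [i'O j'I ij']]]|no] := pselect (exists i j,
    [/\ i \in outputs M, j \in inputs M & i != ord_pred j]).
  by move=> e; exact: (rate_prod_eq apt e i'O j'I ij').
have all i' j' : i' \in outputs M -> j' \in inputs M -> i' = ord_pred j'.
  by move=> h1 h2; apply/eqP/negPn/negP => h3; apply: no; exists i', j'.
have vO : ord_pred j \in outputs M by rewrite -(all i j).
have eO : outputs M = [set ord_pred j]%SET.
  by apply/setP => x; rewrite inE; apply/idP/eqP => [xO|->]; [exact: all|].
have eI : inputs M = [set j]%SET.
  apply/setP => x; rewrite inE; apply/idP/eqP => [xI|-> //].
  by apply: (can_inj (@ord_predK n)); rewrite -(all i x) // -(all i j).
by move=> e; exact: (rate_prod_eq_pred apt e jI vO (leak_interlacing_pred hL eI eO)).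
Qed.

Lemma identifiable_interlacing : leak_interlacing M ->
  generically_locally_identifiable R M.
Proof.
move=> hL; exists [set k | ~ apart k k]; split; first exact: measure_zero_not_apart.
have hL' : (#|leaks M| <= 1)%N \/ (forall l, l \in leaks M ->
    cycle_segment (ordS l) (next (enum (leaks M)) l)
        :&: (inputs M :|: outputs M) != finset.set0).
  by case: hL => _ [|[_]]; [left|right].
move=> k0 /contrapT/(apart_nbhs hM)[U [nU apt]]; exists U; split; first exact: nU.
move=> k k' /set_mem Uk /set_mem Uk' e; have aptkk' := apt _ _ Uk Uk'.
exact: (params_eq aptkk' (apt _ _ Uk' Uk) e (rate_prod_eq_interlacing hL aptkk' e) hL').
Qed.

End Identifiable.

(** * Perturbation of simple real roots *)

Section PerturbRoots.
Variable R : realType.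

Lemma root_sign_change (p : {poly R}) (a b : R) : a <= b -> p.[a] * p.[b] < 0 ->
  exists2 y, a <= y <= b & root p y.
Proof.
move=> ab; have [pa|pa] := leP p.[a] 0 => pab.
  by apply: poly_ivt => //; nra.
have [|y yab] := @poly_ivt _ (- p) a b ab; last by rewrite rootN; exists y.
by rewrite !hornerN; nra.
Qed.

(** Around each simple root the polynomial changes sign, and still does after adding a small [t].
    The intermediate value theorem gives a root near each [x u]; separation by more than 2 d keeps
    them distinct, and n distinct roots factor a monic polynomial of degree n. *)
Lemma perturb_roots (n : nat) (x : 'I_n -> R) (e : R) : (0 < n)%N -> injective x ->
  0 < e -> exists (y : 'I_n -> R) (t : R),
    [/\ t != 0, `|t| < e, forall u, `|y u - x u| < e &
        \prod_u ('X - (y u)%:P) = \prod_u ('X - (x u)%:P) + t%:P].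
Proof.
move=> n0 xinj e0; set f := \prod_u ('X - (x u)%:P).
have [d [d0 de sep]] : exists d, [/\ 0 < d, d < e &
    forall uw : 'I_n * 'I_n, uw.1 != uw.2 -> 2 * d < `|x uw.1 - x uw.2|].
  have : \forall d \near (0 : R)^'+, [/\ 0 < d, d < e &
      forall uw : 'I_n * 'I_n, uw.1 != uw.2 -> 2 * d < `|x uw.1 - x uw.2|].
    have h1 : \forall d \near (0 : R)^'+, 0 < d by exact: nbhs_right_gt.
    have h2 : \forall d \near (0 : R)^'+, d < e by exact: nbhs_right_lt.
    have h3 : \forall d \near (0 : R)^'+, forall uw : 'I_n * 'I_n,
        uw.1 != uw.2 -> 2 * d < `|x uw.1 - x uw.2|.
      apply: filter_forall => -[u w] /=; have [->|uw] := eqVneq u w.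
        exact: nearW.
      have xuw : 0 < `|x u - x w| / 2.
        by rewrite divr_gt0 // normr_gt0 subr_eq0 (inj_eq xinj).
      have := nbhs_right_lt xuw; apply: filterS => d dlt _; lra.
    by apply: filterS3 h1 h2 h3.
  by case/filter_ex => d [h1 h2 h3]; exists d.
have fE u s : f.[x u + s] = s * \prod_(w | w != u) (x u - x w + s).
  rewrite horner_prod (bigD1 u) //= hornerXsubC addrAC subrr add0r; congr (_ * _).
  by apply: eq_bigr => w _; rewrite hornerXsubC addrAC.
(* The product is - d^2 times the product of the (x_u - x_w)^2 - d^2, each positive by
   separation. *)
have fneg u : f.[x u - d] * f.[x u + d] < 0.
  rewrite !fE mulrACA -big_split /= mulNr mulNr oppr_lt0 mulr_gt0 ?mulr_gt0 //.
  apply: prodr_gt0 => w wu.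
  have : 2 * d < `|x u - x w| by apply: (sep (u, w)); rewrite eq_sym.
  rewrite -(ltr_pXn2r (n := 2)) ?nnegrE ?mulr_ge0 ?(ltW d0) // real_normK ?num_real //.
  nra.
have [t [t0 te tneg]] : exists t, [/\ 0 < t, t < e &
    forall u, (f.[x u - d] + t) * (f.[x u + d] + t) < 0].
  have : \forall t \near (0 : R)^'+, [/\ 0 < t, t < e &
      forall u, (f.[x u - d] + t) * (f.[x u + d] + t) < 0].
    have h1 : \forall t \near (0 : R)^'+, 0 < t by exact: nbhs_right_gt.
    have h2 : \forall t \near (0 : R)^'+, t < e by exact: nbhs_right_lt.
    have h3 : \forall t \near (0 : R)^'+,
        forall u, (f.[x u - d] + t) * (f.[x u + d] + t) < 0.
      apply: filter_forall => u.
      have t0 : t @[t --> (0 : R)^'+] --> (0 : R) by apply: cvg_at_right_filter; exact: cvg_id.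
      have ct : (f.[x u - d] + t) * (f.[x u + d] + t) @[t --> (0 : R)^'+] -->
          (f.[x u - d] + 0) * (f.[x u + d] + 0).
        by apply: cvgM; apply: cvgD => //; exact: cvg_cst.
      by apply: (cvgr_lt _ ct); rewrite !addr0.
    by apply: filterS3 h1 h2 h3.
  by case/filter_ex => t [h1 h2 h3]; exists t.
pose F := f + t%:P.
have /boolp.choice[y yP] : forall u, exists z, (x u - d <= z <= x u + d) && root F z.
  move=> u; have [||z zu rz] := @root_sign_change F (x u - d) (x u + d).
  - by lra.
  - by rewrite !hornerD !hornerC.
  - by exists z; rewrite zu.
have yx u : `|y u - x u| <= d.
  by have /andP[yu _] := yP u; rewrite ler_norml; lra.
have yinj : injective y.
  move=> u w yuw; apply/eqP/negPn/negP => uw.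
  have := sep (u, w) uw; rewrite /= ltNge => /negP; apply.
  rewrite (_ : x u - x w = (y w - x w) - (y u - x u)); last by rewrite yuw; ring.
  by apply: (le_trans (ler_normB _ _)); have := yx u; have := yx w; lra.
exists y, t; split => //.
- exact: lt0r_neq0.
- by rewrite gtr0_norm.
- by move=> u; apply: le_lt_trans (yx u) de.
have szf : size f = n.+1 by rewrite size_prod_XsubC size_index_enum_ord.
have szt : (size t%:P < size f)%N by rewrite szf size_polyC; case: (_ == _); lia.
have := @all_roots_prod_XsubC _ F [seq y u | u <- index_enum 'I_n].
rewrite size_map size_index_enum_ord size_polyDl // szf => /(_ erefl).
rewrite lead_coefDl // (monicP (monic_prod_XsubC _ _ _)) scale1r big_map => h.
apply/esym/h.
- by apply/allP => z /mapP[u _ ->]; have /andP[] := yP u.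
- by rewrite uniq_rootsE map_inj_uniq // index_enum_uniq.
Qed.

End PerturbRoots.

(** * Non-interlacing models *)

Section NotIdentifiable.
Variables (R : realType) (n : nat) (M : model n).
Hypotheses (n_gt1 : (1 < n)%N) (hM : directed_cycle M).
Implicit Types k : params R M.

(** Rates [f m] and outflows [o m] define models with leak rates [o m - f m]. They converge to [k]
    with the same coefficients, so any neighbourhood contains one that differs from [k]. *)
Lemma not_locally_injective k (f o : nat -> 'I_n -> R) :
  (forall m v, v \notin leaks M -> f m v = o m v) ->
  (forall v, f m v @[m --> \oo] --> rate k v) ->
  (forall v, o m v @[m --> \oo] --> outflow k v) ->
  (\forall m \near \oo, [/\ exists v, f m v != rate k v,
    \prod_v ('X - (- o m v)%:P) - (\prod_v f m v)%:P = output_poly k &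
    forall i j, i \in outputs M -> j \in inputs M ->
      (path_prod (f m) j i)%:P * off_path_prod (fun v => 'X - (- o m v)%:P) j i =
      input_poly k i j]) ->
  ~ exists U : set (params R M), nbhs k U /\ set_inj U (@coefficient_map R n M).
Proof.
move=> fo cf co coef [U [nU inj]].
pose s m : params R M := mk_params M (f m) (fun v => o m v - f m v).
have so m v : outflow (s m) v = o m v.
  rewrite /outflow rate_mk //; have [vL|vL] := boolP (v \in leaks M).
    by rewrite leak_mk // subrK.
  by rewrite leak_param0 // add0r fo.
have cs : \forall m \near \oo, U (s m).
  have /nbhs_ballP[e /= e0 eU] := nU.
  have : \forall m \near \oo, forall i, ball (k 0 i) e (s m 0 i).
    apply: filter_forall => i.
    have [[v ->]|[l [lL ->]]] := param_indexP hM i.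
      under eq_near do rewrite -!rateE rate_mk //.
      by have /cvgrPdist_lt := cf v; apply.
    under eq_near do rewrite -!leak_paramE leak_mk //.
    have -> : leak_param k l = outflow k l - rate k l by rewrite /outflow addrK.
    have : (o m l - f m l) @[m --> \oo] --> outflow k l - rate k l by exact: cvgB.
    by move=> /cvgrPdist_lt; apply.
  by apply: filterS => m hm; apply: eU; split => // i j; rewrite (ord1 i).
have [m [Us [[v fv] ho hi]]] := filter_ex (filterI cs coef).
suff sk : s m = k by move: fv; rewrite -sk rate_mk // eqxx.
apply: inj; [exact: mem_set Us|exact: mem_set (nbhs_singleton nU)|].
apply/(coefficient_mapP n_gt1 hM); split.
  rewrite -ho output_polyE //; congr (_ - _%:P); apply: eq_bigr => u _.
    by rewrite so.
  by rewrite rate_mk.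
move=> i j iO jI; rewrite -hi // input_polyE //; congr (_%:P * _); apply: eq_bigr => u _.
  by rewrite rate_mk.
by rewrite so.
Qed.

(** The edge out of [l] enters the segment and the edge out of [l'] leaves it. A path that neither
    starts nor ends inside uses both or neither. *)
Lemma segment_path (a l l' i j : 'I_n) : l != l' -> a = ordS l ->
  i \notin cycle_segment a l' -> j \notin cycle_segment a l' ->
  (cycle_dist j l < cycle_dist j i)%N = (cycle_dist j l' < cycle_dist j i)%N.
Proof.
move=> ll' /(congr1 (@nat_of_ord n)); rewrite val_ordS !inE -!/(cycle_dist _ _).
move: ll'; rewrite -val_eqE /= !cycle_distE.
move: (ltn_ord l) (ltn_ord l') (ltn_ord i) (ltn_ord j) (ltn_ord a).
move: (nat_of_ord l) (nat_of_ord l') (nat_of_ord i) (nat_of_ord j) (nat_of_ord a).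
move=> {}l {}l' {}i {}j {}a.
by do 7!case: ifP; lia.
Qed.

Lemma empty_segment_not_injective k (l : 'I_n) : (2 <= #|leaks M|)%N ->
  l \in leaks M -> (forall v, rate k v != 0) ->
  cycle_segment (ordS l) (next (enum (leaks M)) l) :&: (inputs M :|: outputs M)
    = finset.set0 ->
  ~ exists U : set (params R M), nbhs k U /\ set_inj U (@coefficient_map R n M).
Proof.
move=> L2 lL r0 seg0; set l' := next _ l in seg0.
have l'L : l' \in leaks M by rewrite -mem_enum mem_next mem_enum.
(* If [l'] were [l], the closest leak would be at the maximal distance n - 1, so [l] would be the
   only leak. *)
have ll' : l != l'.
  apply/eqP => ll'; have /card_gt1P[u [w [uL wL uw]]] := L2.
  have all_l v : v \in leaks M -> v = l.
    move=> vL; have := next_closest lL vL; rewrite -/l' -ll'.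
    rewrite (cycle_dist_max (erefl (ordS l))) => h; apply: (@cycle_dist_inj _ (ordS l)).
    by rewrite (cycle_dist_max (erefl (ordS l))); have := cycle_dist_lt (ordS l) v; lia.
  by move: uw; rewrite (all_l u) // (all_l w) // eqxx.
have off w : w \in inputs M :|: outputs M -> w \notin cycle_segment (ordS l) l'.
  move=> wio; apply/negP => ws.
  by have : w \in finset.set0; [rewrite -seg0 finset.in_setI ws|rewrite finset.in_set0].
pose t (m : nat) : R := 1 + m.+1%:R^-1.
have ct : t m @[m --> \oo] --> (1 : R).
  by rewrite -[X in _ --> X]addr0; apply: cvgD; [exact: cvg_cst|exact: cvg_harmonic].
have t1 m : 1 < t m by rewrite ltrDl invr_gt0.
have t0 m : t m != 0 by rewrite lt0r_neq0 // (lt_trans ltr01).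
(* The outflows stay fixed, and the factors [t] and 1/[t] cancel in the whole product and, by
   [segment_path], in every path product. *)
pose c m v := if v == l then t m else if v == l' then (t m)^-1 else 1.
have prod_c m (P : pred 'I_n) : P l = P l' -> \prod_(v | P v) c m v = 1.
  move=> Pll'; have [Pl|Pl] := boolP (P l).
    rewrite (bigD1 l) //= (bigD1 l') /=; last by rewrite -Pll' Pl eq_sym.
    rewrite {1 2}/c !eqxx eq_sym (negPf ll') big1 ?mulr1 ?divff // => v.
    by case/andP => /andP[_ vl] vl'; rewrite /c (negPf vl) (negPf vl').
  apply: big1 => v Pv; rewrite /c; case: eqP => [e|_].
    by rewrite -e Pv in Pl.
  by case: eqP => // e; rewrite Pll' -e Pv in Pl.
apply: (@not_locally_injective k (fun m v => rate k v * c m v) (fun=> outflow k)).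
- move=> m v vL; have [vl vl'] : v != l /\ v != l'.
    by split; apply: contraNneq vL => ->.
  by rewrite /c (negPf vl) (negPf vl') mulr1 rate_nonleak.
- move=> v; rewrite -[X in _ --> X]mulr1; apply: cvgM; first exact: cvg_cst.
  rewrite /c; case: (v == l) => //; case: (v == l'); last exact: cvg_cst.
  by rewrite -[X in _ --> X]invr1; apply: cvgV => //; exact: oner_neq0.
- by move=> v; exact: cvg_cst.
apply: nearW => m; split.
- exists l; rewrite /c eqxx -subr_eq0 -{2}(mulr1 (rate k l)) -mulrBr mulf_neq0 //.
  by rewrite subr_eq0 gt_eqF.
- by rewrite output_polyE // big_split /= prod_c // mulr1.
- move=> i j iO jI; rewrite input_polyE //; congr (_%:P * _).
  rewrite /path_prod big_split /= prod_c ?mulr1 //.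
  by apply: (@segment_path (ordS l)) => //; apply: off; rewrite finset.in_setU ?iO ?jI ?orbT.
Qed.

Lemma exceptional_not_injective k : exceptional M -> (forall v, rate k v != 0) ->
  injective (outflow k) ->
  ~ exists U : set (params R M), nbhs k U /\ set_inj U (@coefficient_map R n M).
Proof.
move=> [j [eI eO L2]]; set v := ord_pred j => vL r0 oinj.
have [l [lL lv others]] : exists l, [/\ l \in leaks M, l != v &
    forall u, u != v -> u != l -> u \notin leaks M].
  have /card_gt1P[a [b [aL bL ab]]] : (1 < #|leaks M|)%N by rewrite L2.
  have [l [lL lv]] : exists l, l \in leaks M /\ l != v.
    by have [av|av] := eqVneq a v; [exists b; rewrite -av eq_sym|exists a].
  exists l; split => // u uv ul; apply/negP => uL.
  have : (#|(u |: [set v; l])%SET| <= #|leaks M|)%N.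
    apply/subset_leq_card/fintype.subsetP => w; rewrite !inE.
    by case/or3P => /eqP ->.
  by rewrite L2 cardsU1 cards2 !inE negb_or uv ul eq_sym lv.
pose K := \prod_(u | u != v) rate k u.
have K0 : K != 0 by apply/prodf_neq0.
have KE : K = rate k l * \prod_(u | (u != v) && (u != l)) outflow k u.
  rewrite /K (bigD1 l) //=; congr (_ * _); apply: eq_bigr => u /andP[uv ul].
  by rewrite rate_nonleak // others.
pose Q := \prod_(u | (u != v) && (u != l)) outflow k u.
have Q0 : Q != 0 by apply: contraNneq K0 => e; rewrite KE -/Q e mulr0.
have /boolp.choice[dt dtP] : forall m : nat, exists dt : ('I_n -> R) * R,
    [/\ dt.2 != 0, `|dt.2| < m.+1%:R^-1, forall u, `|dt.1 u - outflow k u| < m.+1%:R^-1 &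
      \prod_u ('X - (- dt.1 u)%:P) = \prod_u ('X - (- outflow k u)%:P) + dt.2%:P].
  move=> m; have [|||y [t [t0 te yx yE]]] := @perturb_roots R n (fun u => - outflow k u) m.+1%:R^-1.
  - exact: ltnW.
  - by move=> a b /oppr_inj/oinj.
  - by rewrite invr_gt0.
  exists (fun u => - y u, t); split => //= [u|].
    by rewrite -normrN opprD !opprK -[outflow k u]opprK; exact: yx.
  by rewrite -yE; apply: eq_bigr => u _; rewrite opprK.
have cd u : (dt m).1 u @[m --> \oo] --> outflow k u.
  apply/cvgrPdist_lt => e e0; have : \forall m \near \oo, @harmonic R m < e.
    by apply: (cvgr_lt _ cvg_harmonic).
  apply: filterS => m hm; rewrite distrC; case: (dtP m) => _ _ /(_ u) h _.
  exact: lt_trans hm.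
have ctt : (dt m).2 @[m --> \oo] --> (0 : R).
  apply/cvgrPdist_lt => e e0; have : \forall m \near \oo, @harmonic R m < e.
    by apply: (cvgr_lt _ cvg_harmonic).
  apply: filterS => m hm; rewrite sub0r normrN; case: (dtP m) => _ h _ _.
  exact: lt_trans hm.
pose q m := \prod_(u | (u != v) && (u != l)) (dt m).1 u.
have cq : q m @[m --> \oo] --> Q by apply: cvg_prodr => u _; exact: cd.
(* The outflows move so that their polynomial gains [t]. Adding [t / K] to rate [v] adds [t] to the
   rate product, rate [l] keeps the product over the other vertices equal to K, and the remaining
   rates must equal their outflows. *)
pose f m u := if u == v then rate k v + (dt m).2 / K else
  if u == l then K / q m else (dt m).1 u.
apply: (@not_locally_injective k f (fun m => (dt m).1)) => //.
- move=> m u uL; have [uv ul] : u != v /\ u != l.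
    by split; apply: contraNneq uL => ->.
  by rewrite /f (negPf uv) (negPf ul).
- move=> u; rewrite /f; have [->|uv] := eqVneq u v.
    rewrite -[X in _ --> X]addr0 -[X in _ --> _ + X](mul0r K^-1).
    by apply: cvgD; [exact: cvg_cst|apply: cvgM => //; exact: cvg_cst].
  have [->|ul] := eqVneq u l.
    have -> : rate k l = K / Q by rewrite KE mulfK.
    by apply: cvgM; [exact: cvg_cst|exact: cvgV].
  by rewrite rate_nonleak ?others.
have : \forall m \near \oo, q m != 0 by exact: (cvgr_neq0 _ cq Q0).
apply: filterS => m qm.
have [t0 _ _ dE] := dtP m.
have fK : \prod_(u | u != v) f m u = K.
  rewrite (bigD1 l) //= /f (negPf lv) eqxx.
  rewrite (eq_bigr (fun u => (dt m).1 u)) => [|u /andP[/negPf -> /negPf -> //]].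
  by rewrite -/(q m) divfK.
split.
- exists v; rewrite /f eqxx -subr_eq0 addrAC subrr add0r mulf_neq0 ?invr_neq0 //.
- rewrite output_polyE // dE -addrA; congr (_ + _).
  rewrite [\prod_(v0 < n) f m v0](bigD1 v) //= fK [X in _ = - X%:P](bigD1 v) //= -/K.
  rewrite {1}/f eqxx mulrDl divfK // polyCD opprD.
  by rewrite addrCA subrr addr0.
move=> i' j'; rewrite eO eI !inE => /eqP -> /eqP ->.
have fK' : path_prod (f m) j (ord_pred j) = K by exact: etrans (path_prod_ord_pred n_gt1 _ _) fK.
rewrite input_poly_ord_pred // fK' /off_path_prod [X in _ * X]big_pred0 ?mulr1 // => w.
by rewrite (cycle_dist_max (ord_predK j)); have := cycle_dist_lt j w; lia.
Qed.

Lemma identifiable_leak_interlacing :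
  generically_locally_identifiable R M -> leak_interlacing M.
Proof.
move=> [Z [Z0 hZ]]; apply: contrapT => nL.
(* In the unit cube at [p0], rates are positive and the outflow of [v] lies in [3v + 1, 3v + 3], so
   the outflows are pairwise distinct. *)
pose p0 : params R M := mk_params M (fun v => 3 * v%:R + 1) (fun=> 0).
have [k nZ kP] := measure_zero_avoid (fun i => p0 0 i) Z0.
have rP (v : 'I_n) : 3 * v%:R + 1 <= rate k v <= 3 * v%:R + 2.
  have := kP (rate_index hM v); rewrite -!rateE rate_mk //.
  by rewrite (_ : 3 * v%:R + 1 + 1 = 3 * v%:R + 2 :> R) //; ring.
have lP (v : 'I_n) : 0 <= leak_param k v <= 1.
  have [vL|vL] := boolP (v \in leaks M); last by rewrite leak_param0 // lexx ler01.
  by have := kP (leak_index vL); rewrite -!leak_paramE leak_mk // add0r.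
have r0 v : rate k v != 0.
  by rewrite lt0r_neq0 //; have := rP v; have : 0 <= v%:R :> R by []; lra.
apply: (_ : ~ exists U : set (params R M),
  nbhs k U /\ set_inj U (@coefficient_map R n M)) (hZ k nZ).
have [exc|nexc] := pselect (exceptional M).
  apply: exceptional_not_injective => // u w.
  wlog uw : u w / (u < w)%N => [h|].
    case: (ltngtP u w) => [/h //|/h h' e|/val_inj //]; exact/esym/h'.
  have : u.+1%:R <= w%:R :> R by rewrite ler_nat.
  rewrite -natr1 /outflow; have := (rP u, rP w); have := lP u; have := lP w.
  move=> lw lu [ru rw] uw' e; exfalso; lra.
have L2 : (2 <= #|leaks M|)%N.
  by rewrite ltnNge; apply/negP => L1; apply: nL; split => //; left.
have [l lL] : exists2 l, l \in leaks M & cycle_segment (ordS l) (next (enum (leaks M)) l)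
        :&: (inputs M :|: outputs M) = finset.set0.
  apply: contrapT => no; apply: nL; split => //; right; split => // l lL.
  by apply/eqP => e; apply: no; exists l.
exact: empty_segment_not_injective.
Qed.

End NotIdentifiable.

Theorem theorem3p6 (R : realType) (n : nat) (hn : (3 <= n)%N) (M : model n)
    (hM : directed_cycle M) :
  generically_locally_identifiable R M <-> leak_interlacing M.
Proof.
have n_gt1 : (1 < n)%N by exact: leq_trans hn.
by split; [exact: identifiable_leak_interlacing|exact: identifiable_interlacing].
Qed.
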